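(* Let $\mathcal{G}_D$ be a patch of four convex quadrilateral cells $K_1,K_2,K_3,K_4$ with common vertex $D$, where $D$ is the only interior vertex of the patch, such that the shape parameters satisfy $\alpha_i=\beta_i=0$ for $i=2,3,4$ (i.e. $K_2,K_3,K_4$ are parallelograms). If $\alpha_1\ne0$ and $\beta_1\neq0$, then for every $v_h\in V_{h0}^{\rm QBL}(\mathcal{G}_D)$ with $v_h\ne0$ there exists a function $\varphi\in C^\infty(\mathcal{G}_D)$ such that $$\sum_{i=1}^4\int_{K_i}\nabla\varphi\cdot\nabla v_h\,dx+\int_{\mathcal{G}_D}\Delta\varphi\,v_h\,dx\ne0.$$
   Context: The patch $\mathcal{G}_D$ is identified with the union of its cells; consecutive cells ($K_i$ and $K_{i+1}$, indices mod 4) share a whole edge having $D$ as an endpoint, $D$ lies in the interior of the union, and all other vertices lie on its boundary. Local coordinates and shape parameters: for a convex quadrilateral $K$ with vertices $A_1,\dots,A_4$ (counterclockwise), edges $e_i=A_iA_{i+1}$ (indices mod 4), $m_i$ the midpoint of $e_i$, let $O$ be the common midpoint of $m_1m_3$ and $m_2m_4$, $r=\overrightarrow{Om_4}$, $s=\overrightarrow{Om_1}$, and let $\xi,\eta$ be the affine functions with $\xi(O+ar+bs)=a$, $\eta(O+ar+bs)=b$. In $(\xi,\eta)$ coordinates the vertices are $A_1=(1+\alpha,1+\beta)$, $A_2=(-1-\alpha,1-\beta)$, $A_3=(-1+\alpha,-1+\beta)$, $A_4=(1-\alpha,-1-\beta)$ for some real $\alpha,\beta$ with $|\alpha|+|\beta|<1$,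 called the shape parameters of $K$; $\alpha_i,\beta_i$ are those of $K_i$. $V_{h0}^{\rm QBL}(\mathcal{G}_D)$ consists of functions $v_h\in L^2(\mathcal{G}_D)$ with $v_h|_{K_i}\in\mathrm{span}\{1,\xi,\eta,\xi\eta\}$ ($\xi,\eta$ the coordinates of $K_i$) for each $i$ that are continuous at the two endpoints of every interior edge and vanish at the two endpoints of every boundary edge of the patch. *)

(* Defs.v *)
From mathcomp Require Import all_boot all_order all_algebra.
From mathcomp Require Import all_classical all_reals all_analysis.
From mathcomp Require Import ring lra.

Set Implicit Arguments.
Unset Strict Implicit.
Unset Printing Implicit Defensive.

Import Order.TTheory GRing.Theory Num.Theory numFieldNormedType.Exports.

Local Open Scope classical_set_scope.
Local Open Scope ring_scope.

(* Lebesgue measure on the plane, which is R * R *)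
Notation area R := (@lebesgue_measure R \x @lebesgue_measure R)%E.

Section Quadrilateral.
Context {R : realType}.
Implicit Types (A : 'I_4 -> R * R) (P Q x u v : R * R).

Definition det2 u v : R := u.1 * v.2 - u.2 * v.1.

Definition midpoint P Q : R * R := 2^-1 *: (P + Q).

(* A quadrilateral is the cyclic list of its vertices: A_1, ..., A_4 are
   A 0, ..., A 3 and indices are added modulo 4 in 'I_4.  The condition says
   that one turns strictly to the left at every vertex; for four points this
   forces a simple, strictly convex, counterclockwise quadrilateral. *)
Definition convex_ccw A : Prop :=
  forall k : 'I_4, 0 < det2 (A (k + 1) - A k) (A (k + 2) - A (k + 1)).

Definition cell A : set (R * R) :=
  [set x | exists t : 'I_4 -> R,
    [/\ forall k, 0 <= t k, \sum_k t k = 1 & x = \sum_k t k *: A k]].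

Definition segment P Q : set (R * R) :=
  [set (1 - t) *: P + t *: Q | t in `[0, 1]%classic].

Definition is_edge A P Q : Prop :=
  exists k : 'I_4, (A k = P /\ A (k + 1) = Q) \/ (A k = Q /\ A (k + 1) = P).

(* m_(k+1), the midpoint of e_(k+1) *)
Definition medge A (k : 'I_4) : R * R := midpoint (A k) (A (k + 1)).

Definition center A : R * R := midpoint (medge A 0) (medge A 2).
Definition rvec A : R * R := medge A 3 - center A.
Definition svec A : R * R := medge A 0 - center A.

(* Cramer's rule for x = center A + xi *: rvec A + eta *: svec A;
   see local_coordsK. *)
Definition xi A x : R := det2 (x - center A) (svec A) / det2 (rvec A) (svec A).
Definition eta A x : R := det2 (rvec A) (x - center A) / det2 (rvec A) (svec A).

(* The vertices then have the coordinates (1 + alpha, 1 + beta),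
   (-1 - alpha, 1 - beta), (-1 + alpha, -1 + beta), (1 - alpha, -1 - beta);
   see vertex_coords. *)
Definition alpha A : R := xi A (A 0) - 1.
Definition beta A : R := eta A (A 0) - 1.

Definition QBL A : set (R * R -> R) :=
  [set p | exists a b c d : R,
    p = fun x => a + b * xi A x + c * eta A x + d * (xi A x * eta A x)].

End Quadrilateral.

Section Patch.
Context {R : realType}.
Implicit Types (K : 'I_4 -> 'I_4 -> R * R) (D P Q : R * R).

Definition boundary (G : set (R * R)) : set (R * R) := closure G `\` G°.

(* K i k is the k-th vertex of the i-th cell. *)
Definition patch_domain K : set (R * R) := \bigcup_(i in [set: 'I_4]) cell (K i).

(* The numbering of the vertices inside each cell is not tied to D, so D may
   be any of the four vertices of a cell. *)
Definition is_patch K D : Prop :=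
  [/\ forall i, convex_ccw (K i),
      forall i j, i != j -> (cell (K i))° `&` (cell (K j))° = set0,
      forall i, exists P, is_edge (K i) D P /\ is_edge (K (i + 1)) D P,
      (patch_domain K)° D &
      forall i k, K i k <> D -> boundary (patch_domain K) (K i k)].

(* An element of L^2 is given by a representative v, and p i is the (unique)
   polynomial which equals v almost everywhere on the i-th cell.  The value
   of v at a vertex, seen from the i-th cell, and the gradient of v on that
   cell are those of p i.  An interior edge is one shared by two cells, a
   boundary edge one lying on the boundary of the patch. *)
Definition VQBL0 K (v : R * R -> R) (p : 'I_4 -> R * R -> R) : Prop :=
  [/\ (v \_ (patch_domain K)) \in Lfun (area R) 2%:E,
      forall i, QBL (K i) (p i) /\ v = p i %[ae (area R) in cell (K i)],
      forall i j P Q, i != j -> is_edge (K i) P Q -> is_edge (K j) P Q ->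
        p i P = p j P /\ p i Q = p j Q &
      forall i P Q, is_edge (K i) P Q ->
        segment P Q `<=` boundary (patch_domain K) -> p i P = 0 /\ p i Q = 0].

End Patch.

Section Calculus.
Context {R : realType}.
Implicit Types (f g : R * R -> R) (G : set (R * R)).

Definition basis_vec (b : bool) : R * R := if b then (0, 1) else (1, 0).
Definition partial (b : bool) f : R * R -> R := 'D_(basis_vec b) f.
Definition partials (s : seq bool) f : R * R -> R := foldr partial f s.

(* C^infinity on a closed set: smooth on some open neighbourhood of it *)
Definition smooth_on G f : Prop :=
  exists U : set (R * R), [/\ open U, G `<=` U &
    forall (s : seq bool) x, U x ->
      (forall b, derivable (partials s f) x (basis_vec b)) /\
      {for x, continuous (partials s f)}].

Definition grad_dot f g (x : R * R) : R :=
  \sum_(b : bool) partial b f x * partial b g x.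
Definition laplacian f (x : R * R) : R :=
  \sum_(b : bool) partial b (partial b f) x.

End Calculus.

Section LocalCoordinates.
Context {R : realType}.
Implicit Types (A : 'I_4 -> R * R).

Let o01 : 0 + 1 = 1 :> 'I_4. Proof. exact: val_inj. Qed.
Let o11 : 1 + 1 = 2 :> 'I_4. Proof. exact: val_inj. Qed.
Let o21 : 2 + 1 = 3 :> 'I_4. Proof. exact: val_inj. Qed.
Let o31 : 3 + 1 = 0 :> 'I_4. Proof. exact: val_inj. Qed.
Let o02 : 0 + 2 = 2 :> 'I_4. Proof. exact: val_inj. Qed.
Let o12 : 1 + 2 = 3 :> 'I_4. Proof. exact: val_inj. Qed.
Let o22 : 2 + 2 = 0 :> 'I_4. Proof. exact: val_inj. Qed.
Let o32 : 3 + 2 = 1 :> 'I_4. Proof. exact: val_inj. Qed.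
Let ord4E := (o01, o11, o21, o31, o02, o12, o22, o32).

Local Ltac expand4 :=
  rewrite /det2 /rvec /svec /center /medge /midpoint !ord4E /=;
  match goal with A : 'I_4 -> _ |- _ =>
    case: (A 0) (A 1) (A 2) (A 3) => [? ?] [? ?] [? ?] [? ?] end;
  rewrite /GRing.scale /=.

Lemma det2_rs_gt0 A : convex_ccw A -> 0 < det2 (rvec A) (svec A).
Proof.
move=> cA; have := cA 0; have := cA 2.
rewrite /det2 /rvec /svec /center /medge /midpoint !ord4E /=.
move: (A 0) (A 1) (A 2) (A 3) => [a1 a2] [b1 b2] [c1 c2] [d1 d2] /=.
rewrite /GRing.scale /=; lra.
Qed.

Lemma local_coordsK A (a b : R) : convex_ccw A ->
  xi A (center A + a *: rvec A + b *: svec A) = a /\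
  eta A (center A + a *: rvec A + b *: svec A) = b.
Proof.
move=> /det2_rs_gt0 /lt0r_neq0; rewrite /xi /eta.
move: (center A) (rvec A) (svec A) => [ c1 c2] [r1 r2] [s1 s2].
rewrite /det2 /= /GRing.scale /= => dpos.
by split; field.
Qed.

Lemma vertex_coords A : convex_ccw A ->
  [/\ (xi A (A 0), eta A (A 0)) = (1 + alpha A, 1 + beta A),
      (xi A (A 1), eta A (A 1)) = (- 1 - alpha A, 1 - beta A),
      (xi A (A 2), eta A (A 2)) = (- 1 + alpha A, - 1 + beta A),
      (xi A (A 3), eta A (A 3)) = (1 - alpha A, - 1 - beta A) &
      `|alpha A| + `|beta A| < 1].
Proof.
move=> cA; have dpos := det2_rs_gt0 cA.
have := cA 3; have := cA 2; have := cA 1; have := cA 0.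
set al := alpha A; set be := beta A; set d := det2 (rvec A) (svec A).
have alE : al * d = det2 (A 0 - center A) (svec A) - d.
  by rewrite /al /alpha /xi -/d; field; rewrite gt_eqF.
have beE : be * d = det2 (rvec A) (A 0 - center A) - d.
  by rewrite /be /beta /eta -/d; field; rewrite gt_eqF.
have E (x y : R) : x * d = y -> y / d = x by move=> <-; rewrite mulfK ?gt_eqF.
move=> c0 c1 c2 c3; split; last first.
- have H (u y : R) : 4 * (u * d) = y -> 0 < y -> 0 < u.
    by move=> <-; rewrite pmulr_rgt0// pmulr_lgt0.
  have h0 : 0 < 1 + al - be.
    by apply: (H _ _ _ c0); rewrite 2!(mulrDl _ _ d) ?mulNr (mul1r d) alE beE /d; expand4; field.
  have h1 : 0 < 1 - al - be.
    by apply: (H _ _ _ c1); rewrite 2!(mulrDl _ _ d) ?mulNr (mul1r d) alE beE /d; expand4; field.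
  have h2 : 0 < 1 - al + be.
    by apply: (H _ _ _ c2); rewrite 2!(mulrDl _ _ d) ?mulNr (mul1r d) alE beE /d; expand4; field.
  have h3 : 0 < 1 + al + be.
    by apply: (H _ _ _ c3); rewrite 2!(mulrDl _ _ d) ?mulNr (mul1r d) alE beE /d; expand4; field.
  by case: (ger0P al) => ?; case: (ger0P be) => ?; lra.
all: congr (_, _); rewrite /xi /eta -/d; apply: E.
all: rewrite (mulrDl _ _ d) ?mulNr (mul1r d) ?alE ?beE /d.
all: by expand4; field.
Qed.

End LocalCoordinates.

(* Main.v *)
(* Write D for the centre of the patch and V = v(D).  The interpolation problem at
   the four vertices of a cell is unisolvent in span{1, xi, eta, xi eta}, and every
   edge missing D lies on the boundary of the patch, so v is determined by V and
   V <> 0.  It suffices to test with linear functions phi, with gradient g: then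
   the Laplacian term vanishes.  On a cell with vertices D, X, F, Y in
   counterclockwise order the remaining integral is
     V (det(g, X - Y) / 2 - 8/3 tau det(g, alpha s - beta r)),
   where tau = (1 - alpha - beta) / (4 (1 - alpha^2 - beta^2)) is the coefficient of
   xi eta per unit of V.  The first terms telescope around D and the second ones
   vanish on parallelograms, so that the total is
     - 8/3 V tau_1 det(g, alpha_1 s_1 - beta_1 r_1);
   take for g a quarter turn of alpha_1 s_1 - beta_1 r_1, which is not 0. *)

Require Import Defs.
From mathcomp Require Import all_boot all_order all_algebra.
From mathcomp Require Import all_classical all_reals all_analysis.
From mathcomp Require Import measurable_realfun ring lra.

Set Implicit Arguments.
Unset Strict Implicit.
Unset Printing Implicit Defensive.

Import Order.TTheory GRing.Theory Num.Theory numFieldNormedType.Exports.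

Local Open Scope classical_set_scope.
Local Open Scope ring_scope.

(** * Affine changes of variables for the area *)

Section ScalingMaps.
Context {R : realType}.
Local Notation plane := (measurableTypeR R * measurableTypeR R)%type.
Local Notation leb := (@lebesgue_measure R).

(** By uniqueness of Lebesgue measure it suffices to compare both sides on half-open intervals. A
    negative [c] swaps the endpoints and moves the closed end to the left, which leaves the length
    unchanged. *)
Lemma lebesgue_measure_affine (c e : R) (A : set R) : c != 0 -> measurable A ->
  leb A = (`|c|%:E * leb ((fun y => (c * y + e)%R) @^-1` A))%E.
Proof.
move=> c0 mA.
have mphi : measurable_fun setT (fun y : measurableTypeR R => c * y + e : measurableTypeR R).
  by apply: measurable_funD => //; apply: measurable_funM.
pose m := mscale (NngNum (normr_ge0 c))
  (pushforward leb (fun y : measurableTypeR R => c * y + e : measurableTypeR R)).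
rewrite (@lebesgue_measure_unique R (m mphi)) => //.
move=> _ [[a b] _ <-] /=; rewrite /m /= /mscale /= /pushforward.
have [c1|c1] := ltP 0 c.
  rewrite (_ : _ @^-1` _ = `](a - e) / c, (b - e) / c]%classic); last first.
    apply/seteqP; split => y /=; rewrite !in_itv /= ltr_pdivrMr // ler_pdivlMr //;
      by rewrite ltrBlDr lerBrDr mulrC.
  rewrite !lebesgue_measure_itv /= !lte_fin ltr_pM2r ?invr_gt0 // ltrD2r.
  case: ifP => _; last by rewrite mule0.
  by rewrite gtr0_norm // -!EFinB -EFinM; congr EFin; field.
have {c1} c1 : c < 0 by rewrite lt_neqAle c0.
rewrite (_ : _ @^-1` _ = `[(b - e) / c, (a - e) / c[%classic); last first.
  apply/seteqP; split => y /=; rewrite !in_itv /= ler_ndivrMr // ltr_ndivlMr //;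
    by rewrite ltrBlDr lerBrDr mulrC andbC.
rewrite !lebesgue_measure_itv /= !lte_fin ltr_nM2r ?invr_lt0 // ltrD2r.
case: ifP => _; last by rewrite mule0.
by rewrite ltr0_norm // -!EFinB -EFinM; congr EFin; field.
Qed.

(** For an invertible affine [phi], [c] is the absolute value of its Jacobian determinant. In terms
    of preimages the condition says that the area is [c] times its own pushforward, a form that
    composes and passes directly to integrals. *)
Definition area_scaling (c : R) (phi : plane -> plane) :=
  [/\ 0 <= c, measurable_fun setT phi & forall S : set plane, measurable S ->
    area R S = (c%:E * area R (phi @^-1` S))%E].

Lemma area_scaling_comp c d phi psi :
  area_scaling c phi -> area_scaling d psi -> area_scaling (c * d) (phi \o psi).
Proof.
move=> [c0 mphi sphi] [d0 mpsi spsi]; split; first exact: mulr_ge0.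
- exact: measurableT_comp.
- move=> S mS; rewrite sphi // EFinM -muleA comp_preimage -spsi //.
  by rewrite -[X in measurable X]setTI; exact: mphi.
Qed.

(** Fubini: over each abscissa [x] the map acts on the vertical section as the affine map with
    factor [c] and shift [h x], so the one-dimensional result applies section by section. *)
Lemma area_scaling_vert (c : R) (h : R -> R) : c != 0 -> measurable_fun setT h ->
  area_scaling `|c| (fun x : plane => (x.1, c * x.2 + h x.1)).
Proof.
move=> c0 mh; have mphi : measurable_fun setT (fun x : plane => (x.1, c * x.2 + h x.1) : plane).
  apply/measurable_fun_pairP; split => /=; first exact: measurable_fst.
  apply: measurable_funD; last exact: measurableT_comp.
  by apply: measurable_funM => //; exact: measurable_snd.
split => // S mS; rewrite /product_measure1 -ge0_integralZl //.
  apply: eq_integral => x _ /=.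
  by rewrite (@lebesgue_measure_affine c (h x)) //; exact: measurable_xsection.
have mS' : measurable ((fun x : plane => (x.1, c * x.2 + h x.1) : plane) @^-1` S).
  by rewrite -[X in measurable X]setTI; exact: mphi.
exact: (measurable_fun_xsection leb mS').
Qed.

(** Uniqueness of the product measure leaves only rectangles to check. *)
Lemma area_scaling_swap : area_scaling 1 (fun x : plane => (x.2, x.1)).
Proof.
have ms : measurable_fun setT (fun x : plane => (x.2, x.1) : plane) by exact: measurable_swap.
split => // S mS; rewrite mul1e.
pose m : {measure set plane -> \bar R} :=
  pushforward (area R) (fun x : plane => (x.2, x.1) : plane).
suff H : forall A B, measurable A -> measurable B -> m ms (A `*` B) = (leb A * leb B)%E.
  exact: (@product_measure_unique _ _ _ _ R leb leb (m ms) H S mS).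
move=> A B mA mB.
rewrite /m /= /pushforward /= (_ : _ @^-1` _ = B `*` A); last first.
  by apply/seteqP; split => -[x y] /= [].
by rewrite product_measure1E //= muleC.
Qed.

Lemma area_scaling_horz (c : R) (h : R -> R) : c != 0 -> measurable_fun setT h ->
  area_scaling `|c| (fun x : plane => (c * x.1 + h x.2, x.2)).
Proof.
move=> c0 mh.
have := area_scaling_comp (area_scaling_comp area_scaling_swap (area_scaling_vert c0 mh))
  area_scaling_swap.
by rewrite mul1r mulr1.
Qed.

(** Change of variables by pushforward. The sign condition on [f] replaces integrability. *)
Lemma Rintegral_area_scaling (c : R) (phi : plane -> plane) (D : set plane) (f : plane -> R) :
  area_scaling c phi -> measurable D -> measurable_fun setT f -> (forall x, D x -> 0 <= f x) ->
  \int[area R]_(x in D) f x = c * \int[area R]_(x in phi @^-1` D) f (phi x).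
Proof.
move=> [c0 mphi sphi] mD mf f0.
have mEf : measurable_fun D (EFin \o f) by apply/measurable_EFinP; exact: measurable_funTS.
have -> : \int[area R]_(x in D) f x =
    fine (c%:E * \int[area R]_(x in phi @^-1` D) (f (phi x))%:E)%E.
  rewrite /Rintegral; congr fine.
  pose m : {measure set plane -> \bar R} := pushforward (area R) phi.
  rewrite (eq_measure_integral (mscale (NngNum c0) (m mphi))) => [|A mA _]; last exact: sphi.
  have f0' x : D x -> (0 <= (f x)%:E)%E by move=> /f0; rewrite lee_fin.
  apply: (etrans (ge0_integral_mscale (m mphi) mD (NngNum c0) mEf f0')).
  apply: (congr1 (fun z => (c%:E * z)%E)).
  apply: (ge0_integral_pushforward mphi (area R) mD mEf) => x.
  by rewrite inE => /f0'.
(* [fine] sends infinite values to 0, so [c] also comes out of an infinite integral; [c = 0] is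
   treated apart. *)
rewrite /Rintegral; case: (\int[_]_(_ in _) _)%E => //= [|];
  have := c0; rewrite le_eqVlt => /predU1P[<-|cp]; rewrite ?mul0e ?mulr0 ?mul0r //.
- by rewrite gt0_muley ?lte_fin.
- by rewrite gt0_muleNy ?lte_fin.
Qed.

End ScalingMaps.

(** * Integrals over triangles and cells *)

Section TriangleIntegrals.
Context {R : realType}.
Local Notation plane := (measurableTypeR R * measurableTypeR R)%type.
Local Notation leb := (@lebesgue_measure R).
Implicit Types A B C u v x : R * R.

Definition affine_form (a b c : R) : R * R -> R := fun x => a + b * x.1 + c * x.2.

Lemma measurable_affine_form (a b c : R) :
  measurable_fun setT (affine_form a b c : plane -> R).
Proof.
apply: measurable_funD; first apply: measurable_funD => //.
  by apply: measurable_funM => //; exact: measurable_fst.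
by apply: measurable_funM => //; exact: measurable_snd.
Qed.

Lemma measurable_halfplane (a b c : R) :
  measurable ([set x : plane | 0 <= affine_form a b c x] : set plane).
Proof.
have := @measurable_affine_form a b c measurableT `[0, +oo[%classic (measurable_itv _).
rewrite setTI; congr (measurable _); apply/seteqP.
by split => x; rewrite /= in_itv /= andbT.
Qed.

Definition frame_map A u v : plane -> plane :=
  fun x => (A.1 + x.1 * u.1 + x.2 * v.1, A.2 + x.1 * u.2 + x.2 * v.2).

(** If [u.1] is nonzero, Gaussian elimination factors the map into a horizontal one with factor
    [u.1] followed by a vertical one whose factor is the Schur complement [det2 u v / u.1]. *)
Lemma area_scaling_frame_map A u v : det2 u v != 0 ->
  area_scaling `|det2 u v| (frame_map A u v).
Proof.
have meas (a b : R) : measurable_fun setT (fun y : R => a * y + b).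
  by apply: measurable_funD => //; apply: measurable_funM.
have main u' : u'.1 != 0 -> det2 u' v != 0 ->
    area_scaling `|det2 u' v| (frame_map A u' v).
  move=> u0 d0; pose c := v.2 - u'.2 * v.1 / u'.1.
  have dE : det2 u' v = u'.1 * c by rewrite /c /det2; field.
  have c0 : c != 0 by apply: contra_neq d0; rewrite dE => ->; rewrite mulr0.
  have mh := meas (u'.2 / u'.1) (A.2 - u'.2 / u'.1 * A.1).
  have := area_scaling_comp (area_scaling_vert c0 mh) (area_scaling_horz u0 (meas v.1 A.1)).
  rewrite -normrM mulrC -dE; congr area_scaling; apply/funext => x.
  by rewrite /frame_map /c /=; congr (_, _); [ring | field].
have [u0|u0] := eqVneq u.1 0; last exact: main.
(* Precompose with the shear (s, t) |-> (s, t + s), which turns the frame (u - v, v) into (u, v). *)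
move=> d0; have v0 : v.1 != 0.
  by apply: contra_neq d0 => v0; rewrite /det2 u0 v0; ring.
have dE : det2 (u - v) v = det2 u v by rewrite /det2 /=; ring.
have := area_scaling_comp (main (u - v) _ _) (area_scaling_vert (oner_neq0 R) (meas 1 0)).
rewrite dE normr1 mulr1 /= u0 sub0r oppr_eq0 => /(_ v0 d0).
congr area_scaling; apply/funext => x.
by rewrite /frame_map /=; congr (_, _); ring.
Qed.

Lemma frame_mapK A u v x : det2 u v != 0 ->
  frame_map A u v (det2 (x - A) v / det2 u v, det2 u (x - A) / det2 u v) = x.
Proof.
by move=> d0; rewrite [RHS]surjective_pairing /frame_map /=; congr (_, _);
  move: d0; rewrite /det2 /= => d0; field.
Qed.

Lemma measurable_line A u : measurable [set x : plane | det2 u (x - A) = 0].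
Proof.
pose k := u.2 * A.1 - u.1 * A.2.
rewrite (_ : mkset _ = [set x : plane | 0 <= affine_form k (- u.2) u.1 x] `&`
  [set x : plane | 0 <= affine_form (- k) u.2 (- u.1) x]).
  by apply: measurableI; exact: measurable_halfplane.
by apply/seteqP; split => x /=; rewrite /k /affine_form /det2 /=; lra.
Qed.

(** In the frame formed by [u] and its quarter turn [v], the line becomes the first coordinate axis,
    a product with a null factor. *)
Lemma area_line A u : u != 0 -> area R [set x : plane | det2 u (x - A) = 0] = 0%E.
Proof.
move=> u0; pose v : R * R := (- u.2, u.1).
have d0 : det2 u v != 0.
  apply: contra_neq u0; rewrite /det2 /= mulrN opprK => /eqP.
  rewrite paddr_eq0 ?sqr_ge0 -?expr2 // !sqrf_eq0 => /andP[/eqP u1 /eqP u2].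
  by rewrite [u]surjective_pairing u1 u2.
have [_ _ ->] := area_scaling_frame_map A d0; last exact: measurable_line.
rewrite (_ : _ @^-1` _ = setT `*` [set 0]); last first.
  apply/seteqP; split => x /=.
    rewrite (_ : det2 _ _ = x.2 * det2 u v) => [/eqP|]; last by rewrite /det2 /=; ring.
    by rewrite mulf_eq0 (negbTE d0) orbF => /eqP.
  by move=> [_ x0]; rewrite /det2 /= x0; ring.
by rewrite product_measure1E //= lebesgue_measure_set1 !mule0.
Qed.

Definition ref_triangle : set plane := [set x | [/\ 0 <= x.1, 0 <= x.2 & x.1 + x.2 <= 1]].

Lemma measurable_ref_triangle : measurable ref_triangle.
Proof.
rewrite (_ : ref_triangle = [set x : plane | 0 <= affine_form 0 1 0 x] `&`
  [set x : plane | 0 <= affine_form 0 0 1 x] `&` [set x : plane | 0 <= affine_form 1 (-1) (-1) x]).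
  by do 2?[apply: measurableI]; exact: measurable_halfplane.
apply/seteqP; split => x; rewrite /ref_triangle /affine_form /=.
  by move=> [? ? ?]; split; [split|]; lra.
by move=> [[? ?] ?]; split; lra.
Qed.

(** The point reflection of the unit square [Q] in its centre exchanges the complement of the
    triangle with the triangle deprived of its hypotenuse. The latter lies on the null line [L], so
    the square of area 1 is twice the triangle. *)
Lemma area_ref_triangle : area R ref_triangle = 2^-1%:E.
Proof.
have mT := measurable_ref_triangle.
pose Q : set plane := `[0, 1]%classic `*` `[0, 1]%classic.
have mQ : measurable Q by apply: measurableX.
pose L : set plane := [set x : plane | det2 (-1, 1) (x - (1, 0)) = 0].
have L0 : area R L = 0%E by apply: area_line; rewrite xpair_eqE oner_eq0 andbF.
have TQ : ref_triangle `<=` Q.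
  by move=> x [? ? ?]; split; rewrite /= in_itv /=; apply/andP; split; lra.
have mQT : measurable (Q `\` ref_triangle) by exact: measurableD.
have areaQ : area R Q = 1%:E.
  have I1 : leb `[0, 1]%classic = 1%:E.
    by rewrite lebesgue_measure_itv /= lte_fin ltr01 -EFinD subr0.
  by rewrite product_measure1E //= I1 mule1.
have mL : measurable L by exact: measurable_line.
have d1 : det2 (-1, 0) (0, -1) = 1 :> R by rewrite /det2 /=; ring.
have d0 : det2 (-1, 0) (0, -1) != 0 :> R by rewrite d1 oner_neq0.
have := area_scaling_frame_map (1, 1) d0.
rewrite d1 normr1 => -[_ _ /(_ _ mQT)]; rewrite mul1e.
rewrite (_ : _ @^-1` _ = ref_triangle `\` L); last first.
  apply/seteqP; split => x; rewrite /Q /L /ref_triangle /frame_map /det2 /= !in_itv /=.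
    move=> [[/andP[? ?] /andP[? ?]] N]; split; last first.
      by move=> ?; apply: N; split; lra.
    have : ~ (1 + x.1 * - 1 + x.2 * 0 + (1 + x.1 * 0 + x.2 * - 1) <= 1).
      by move=> ?; apply: N; split; lra.
    by move/negP; rewrite -ltNge => ?; split; lra.
  move=> [[? ? ?] N]; split; first by split; apply/andP; split; lra.
  by move=> [? ? ?]; apply: N; lra.
have -> : area R (ref_triangle `\` L) = area R ref_triangle.
  apply/eqP; rewrite eq_le; apply/andP; split.
    by apply: le_measure; rewrite ?inE //; exact: measurableD.
  have mTL : measurable (ref_triangle `\` L) by exact: measurableD.
  have : (area R (ref_triangle `\` L `|` L) <= area R (ref_triangle `\` L) + area R L)%E.
    exact: (measureU2 (area R) mTL mL).
  rewrite L0 adde0; apply: le_trans.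
  apply: le_measure; rewrite ?inE //; first exact: measurableU.
  by move=> x Tx; case: (pselect (L x)) => [|?]; [right | left].
move=> QT; have : area R Q = (area R ref_triangle + area R ref_triangle)%E.
  rewrite -[X in (_ = _ + X)%E]QT -[in LHS](setDUK TQ).
  by apply: (measureU (area R)) => //; rewrite setDE setICA setICr setI0.
rewrite areaQ; case: (area R ref_triangle) => //= r.
by rewrite -EFinD => -[] ?; congr EFin; lra.
Qed.

End TriangleIntegrals.

Section CellIntegrals.
Context {R : realType}.
Local Notation plane := (measurableTypeR R * measurableTypeR R)%type.
Implicit Types A u v x : R * R.

Lemma integrable_affine_form (D : set plane) (M a b c : R) : measurable D ->
  (area R D < +oo)%E -> (forall x, D x -> `|x.1| <= M /\ `|x.2| <= M) ->
  (area R).-integrable D (EFin \o affine_form a b c).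
Proof.
move=> mD Doo DM; apply: (measurable_bounded_integrable (mu := area R)) => //.
  by apply: measurable_funTS; exact: measurable_affine_form.
exists (`|a| + `|b| * M + `|c| * M); split; first exact: num_real.
move=> N MN x Dx; have [x1 x2] := DM x Dx; apply: le_trans (ltW MN).
apply: le_trans (ler_normD _ _) _; apply: lerD; last by rewrite normrM ler_wpM2l.
by apply: le_trans (ler_normD _ _) _; rewrite normrM lerD2l ler_wpM2l.
Qed.

Let integrable_ref (a b c : R) : (area R).-integrable ref_triangle (EFin \o affine_form a b c).
Proof.
apply: (@integrable_affine_form _ 1); first exact: measurable_ref_triangle.
  by rewrite area_ref_triangle ltry.
by move=> x [? ? ?]; rewrite !ger0_norm //; split; lra.
Qed.

Let Rintegral_area_cst (D : set plane) (r : R) : measurable D ->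
  \int[area R]_(x in D) r = r * fine (area R D).
Proof. by move=> mD; exact: (Rintegral_cst (area R) mD). Qed.

(** By linearity only 1 and the two coordinates matter. The three barycentric coordinates have equal
    integrals by symmetry, and they add up to 1, whose integral is 1/2; so each integral is 1/6. *)
Lemma Rintegral_ref_triangle (a b c : R) :
  \int[area R]_(x in ref_triangle) affine_form a b c x = a / 2 + b / 6 + c / 6.
Proof.
have mT := @measurable_ref_triangle R.
pose I a b c := \int[area R]_(x in ref_triangle) affine_form a b c x.
have ID a1 b1 c1 a2 b2 c2 : I (a1 + a2) (b1 + b2) (c1 + c2) = I a1 b1 c1 + I a2 b2 c2.
  rewrite /I -RintegralD //; apply: eq_Rintegral => x _.
  by rewrite /affine_form; ring.
have IZ k a1 b1 c1 : I (k * a1) (k * b1) (k * c1) = k * I a1 b1 c1.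
  rewrite /I -RintegralZl //; apply: eq_Rintegral => x _.
  by rewrite /affine_form; ring.
have I1 : I 1 0 0 = 2^-1.
  transitivity (\int[area R]_(x in @ref_triangle R) (1 : R)).
    by apply: eq_Rintegral => x _; rewrite /affine_form; ring.
  by rewrite Rintegral_area_cst // area_ref_triangle /= mul1r.
have pos1 x : ref_triangle x -> 0 <= affine_form 0 1 0 x.
  by move=> [? ? ?]; rewrite /affine_form; lra.
have m1 : measurable_fun setT (affine_form 0 1 0 : plane -> R) by exact: measurable_affine_form.
have I12 : I 0 1 0 = I 0 0 1.
  rewrite /I (Rintegral_area_scaling area_scaling_swap mT m1 pos1) mul1r.
  rewrite (_ : _ @^-1` _ = ref_triangle); last first.
    by apply/seteqP; split => x [? ? ?]; split => //=; rewrite addrC.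
  by apply: eq_Rintegral => x _; rewrite /affine_form /=; ring.
(* The affine map (s, t) |-> (1 - s - t, t) permutes the vertices of the reference triangle. *)
have I10 : I 0 1 0 = I 1 (-1) (-1).
  have meas (e d : R) : measurable_fun setT (fun y : R => d * y + e).
    by apply: measurable_funD => //; apply: measurable_funM.
  have n0 : (-1 : R) != 0 by rewrite oppr_eq0 oner_neq0.
  rewrite /I (Rintegral_area_scaling (area_scaling_horz n0 (meas 1 (-1))) mT m1 pos1).
  rewrite normrN1 mul1r (_ : _ @^-1` _ = ref_triangle); last first.
    by apply/seteqP; split => x [/= ? ? ?]; split => //=; lra.
  by apply: eq_Rintegral => x _; rewrite /affine_form /=; ring.
have I1E : I 0 1 0 = 6^-1.
  have : I 1 0 0 = I 1 (-1) (-1) + I 0 1 0 + I 0 0 1 by rewrite -!ID; congr (I _ _ _); ring.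
  by rewrite I1 -I10 -I12; lra.
have -> : affine_form a b c = affine_form (a * 1 + b * 0 + c * 0) (a * 0 + b * 1 + c * 0)
    (a * 0 + b * 0 + c * 1) by rewrite !(mulr0, mulr1, addr0, add0r).
by rewrite -/(I _ _ _) !ID !IZ I1 -I12 I1E.
Qed.

(** For a nonzero determinant this is the triangle with vertices [A], [A + u], [A + v]. Cramer's
    rule presents it as a preimage of [ref_triangle] under an affine map, which gives
    measurability. *)
Definition triangle A u v : set plane :=
  [set x | ref_triangle (det2 (x - A) v / det2 u v, det2 u (x - A) / det2 u v)].

Lemma frame_map_triangle A u v : det2 u v != 0 ->
  frame_map A u v @^-1` triangle A u v = ref_triangle.
Proof.
move=> d0; apply/funext => y; rewrite /triangle /preimage /=; congr ref_triangle.
rewrite [RHS]surjective_pairing /frame_map; congr (_, _);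
  by move: d0; rewrite /det2 /= => d0; field.
Qed.

Lemma measurable_triangle A u v : measurable (triangle A u v).
Proof.
pose d := det2 u v.
pose l1 := affine_form ((A.2 * v.1 - A.1 * v.2) / d) (v.2 / d) (- v.1 / d).
pose l2 := affine_form ((A.1 * u.2 - A.2 * u.1) / d) (- u.2 / d) (u.1 / d).
have E x : (det2 (x - A) v / d, det2 u (x - A) / d) = (l1 x, l2 x).
  by rewrite /l1 /l2 /affine_form /det2 /=; congr (_, _); ring.
have mf : measurable_fun setT (fun x : plane => (l1 x, l2 x) : plane).
  by apply: measurable_fun_pair; exact: measurable_affine_form.
have := mf measurableT _ measurable_ref_triangle; rewrite setTI.
by congr measurable; apply/funext => x; rewrite /triangle /preimage /= E.
Qed.

Lemma triangle_frame A u v x : det2 u v != 0 -> triangle A u v x ->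
  exists2 y, ref_triangle y & x = frame_map A u v y.
Proof. by move=> d0 Tx; eexists; first exact: Tx; rewrite frame_mapK. Qed.

Lemma area_triangle A u v : det2 u v != 0 ->
  area R (triangle A u v) = (`|det2 u v| / 2)%:E.
Proof.
move=> d0; have [_ _ ->] := area_scaling_frame_map A d0; last exact: measurable_triangle.
by rewrite frame_map_triangle // area_ref_triangle EFinM.
Qed.

Lemma triangle_bounded A u v : det2 u v != 0 ->
  exists M, forall x, triangle A u v x -> `|x.1| <= M /\ `|x.2| <= M.
Proof.
move=> d0; pose N (w : R * R) := `|w.1| + `|w.2|.
exists (N A + N u + N v) => x /(triangle_frame d0)[y [y1 y2 y12] ->]; rewrite /frame_map /=.
have H (p q r : R) : `|p + y.1 * q + y.2 * r| <= `|p| + `|q| + `|r|.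
  do 2?[apply: le_trans (ler_normD _ _) _; apply: lerD => //];
    by rewrite normrM ger0_norm // ler_piMl //; lra.
have := (normr_ge0 A.1, normr_ge0 A.2, normr_ge0 u.1, normr_ge0 u.2).
have := (normr_ge0 v.1, normr_ge0 v.2); rewrite /N => -[? ?] [[[? ?] ?] ?].
by split; (apply: le_trans (H _ _ _) _; lra).
Qed.

Lemma integrable_triangle A u v (a b c : R) : det2 u v != 0 ->
  (area R).-integrable (triangle A u v) (EFin \o affine_form a b c).
Proof.
move=> d0; have [M TM] := triangle_bounded A d0.
apply: (integrable_affine_form (M := M)) => //; first exact: measurable_triangle.
by rewrite area_triangle // ltry.
Qed.

(** The vertex rule, area times mean of the vertex values, is exact for affine functions. *)
Lemma Rintegral_triangle A u v (a b c : R) (f := affine_form a b c) : det2 u v != 0 ->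
  \int[area R]_(x in triangle A u v) f x =
  `|det2 u v| * (f A + f (A + u) + f (A + v)) / 6.
Proof.
move=> d0; have mT := @measurable_triangle A u v.
pose f1 := f (A + u) - f A; pose f2 := f (A + v) - f A.
(* [M] bounds the modulus of [f] on the triangle: [f + M] is nonnegative there, as the change of
   variables requires, and the constant is subtracted again. *)
pose M := `|f A| + `|f1| + `|f2|.
have fE y : f (frame_map A u v y) = affine_form (f A) f1 f2 y.
  by rewrite /f1 /f2 /f /affine_form /=; ring.
have fM x : triangle A u v x -> 0 <= affine_form (a + M) b c x.
  move=> /(triangle_frame d0)[y [y1 y2 y12] ->].
  have -> : affine_form (a + M) b c (frame_map A u v y) = affine_form (f A) f1 f2 y + M.
    by rewrite -fE /f /affine_form; ring.
  have h (k z : R) : 0 <= k -> k <= 1 -> - `|z| <= z * k.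
    by move=> k0 k1; have := ler_norm z; have := ler_norm (- z); rewrite normrN; nra.
  have := h y.1 f1; have := h y.2 f2; have := h 1 (f A).
  by rewrite /affine_form /M => /(_ ler01 (lexx _)) ? /(_ y2) ? /(_ y1) ?; lra.
transitivity (\int[area R]_(x in triangle A u v)
    (affine_form (a + M) b c x + affine_form (- M) 0 0 x)).
  by apply: eq_Rintegral => x _; rewrite /f /affine_form; ring.
rewrite RintegralD //; [|exact: integrable_triangle|exact: integrable_triangle].
rewrite (Rintegral_area_scaling (area_scaling_frame_map A d0) mT _ fM);
  last exact: measurable_affine_form.
rewrite frame_map_triangle //.
under eq_Rintegral.
  move=> y _.
  have -> : affine_form (a + M) b c (frame_map A u v y) = affine_form (f A + M) f1 f2 y.
    by move: (fE y); rewrite /f /affine_form => E; lra.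
  over.
rewrite Rintegral_ref_triangle.
under eq_Rintegral do rewrite /affine_form !mul0r !addr0.
by rewrite Rintegral_area_cst // area_triangle //= /f1 /f2; field.
Qed.

End CellIntegrals.

(** * Renumbering the vertices of a cell and cutting it along a diagonal *)

Section CellGeometry.
Context {R : realType}.
Local Notation plane := (measurableTypeR R * measurableTypeR R)%type.
Implicit Types A : 'I_4 -> R * R.

Lemma sum_ord4 (V : nmodType) (F : 'I_4 -> V) : \sum_k F k = F 0 + F 1 + F 2 + F 3.
Proof.
rewrite !big_ord_recl big_ord0 addr0 !addrA.
by congr (F _ + F _ + F _ + F _); exact: val_inj.
Qed.

Lemma fstsndE : ((forall P Q : R * R, (P + Q).1 = P.1 + Q.1) *
  (forall P Q : R * R, (P + Q).2 = P.2 + Q.2) *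
  (forall P : R * R, (- P).1 = - P.1) * (forall P : R * R, (- P).2 = - P.2) *
  (forall (k : R) (P : R * R), (k *: P).1 = k * P.1) *
  (forall (k : R) (P : R * R), (k *: P).2 = k * P.2)).
Proof. by []. Qed.

Lemma eq_plane (P Q : R * R) : P.1 = Q.1 -> P.2 = Q.2 -> P = Q.
Proof. by case: P Q => [? ?] [? ?] /= -> ->. Qed.

Lemma ord4D : ((0 + 1)%R = 1 :> 'I_4) * ((1 + 1)%R = 2 :> 'I_4) * ((2 + 1)%R = 3 :> 'I_4) *
  ((3 + 1)%R = 0 :> 'I_4) * ((0 + 2)%R = 2 :> 'I_4) * ((1 + 2)%R = 3 :> 'I_4) *
  ((2 + 2)%R = 0 :> 'I_4) * ((3 + 2)%R = 1 :> 'I_4).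
Proof. by do !split; exact: val_inj. Qed.

Lemma ord4_ind (P : 'I_4 -> Prop) : P 0 -> P 1 -> P 2 -> P 3 -> forall k, P k.
Proof.
move=> P0 P1 P2 P3 [[|[|[|[|//]]]] lt_k4].
- by rewrite (_ : Ordinal _ = 0) //; exact: val_inj.
- by rewrite (_ : Ordinal _ = 1) //; exact: val_inj.
- by rewrite (_ : Ordinal _ = 2) //; exact: val_inj.
- by rewrite (_ : Ordinal _ = 3) //; exact: val_inj.
Qed.

(** The vertex [D] may have any index in a cell; this rotation of the numbering serves to give it
    index 0. *)
Definition relabel A (k : 'I_4) : 'I_4 -> R * R := fun j => A (k + j).

Lemma convex_ccw_relabel A k : convex_ccw A -> convex_ccw (relabel A k).
Proof. by move=> cA j; have := cA (k + j); rewrite /relabel (addrA k j 1) (addrA k j 2). Qed.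

Lemma cell_relabel A k : cell (relabel A k) = cell A.
Proof.
apply/seteqP; split => x [t [t0 t1 ->]].
  exists (fun j => t (j - k)); split => //.
    by rewrite -t1 [RHS](reindex_inj (addIr (- k))).
  rewrite [LHS](reindex_inj (addIr (- k))) /=; apply: eq_bigr => j _.
  by rewrite /relabel [k + _]addrC subrK.
exists (fun j => t (k + j)); split => //.
  by rewrite -t1 [RHS](reindex_inj (addrI k)).
by rewrite [LHS](reindex_inj (addrI k)).
Qed.

Lemma is_edge_relabel A k P Q : is_edge (relabel A k) P Q <-> is_edge A P Q.
Proof.
split => -[j H].
  by exists (k + j); rewrite -addrA.
have jE : k + (j - k) = j by rewrite addrC subrK.
by exists (j - k); rewrite /relabel (addrA k (j - k) 1) jE.
Qed.

Lemma convex_ccw_det A : convex_ccw A ->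
  [/\ 0 < det2 (A 1 - A 0) (A 2 - A 0), 0 < det2 (A 2 - A 0) (A 3 - A 0),
      0 < det2 (A 1 - A 0) (A 3 - A 0) & 0 < det2 (A 2 - A 1) (A 3 - A 1)].
Proof.
move=> cA; have := (cA 0, cA 1, cA 2, cA 3).
by rewrite !ord4D /det2 /= => -[[[? ?] ?] ?]; split; lra.
Qed.

Lemma relabel1E A :
  (relabel A 1 0 = A 1) * (relabel A 1 1 = A 2) * (relabel A 1 2 = A 3) * (relabel A 1 3 = A 0).
Proof. by do !split; congr A; exact: val_inj. Qed.

Lemma triangle_frame_map B u v (s t : R) : det2 u v != 0 -> 0 <= s -> 0 <= t -> s + t <= 1 ->
  triangle B u v (B + s *: u + t *: v).
Proof.
move=> d0 s0 t0 st; have : ref_triangle (s, t) by [].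
rewrite -(frame_map_triangle B d0) /preimage /= /frame_map /=.
by congr triangle; rewrite [RHS]surjective_pairing.
Qed.

Lemma cell_triangles A : convex_ccw A ->
  cell A = triangle (A 0) (A 1 - A 0) (A 2 - A 0) `|` triangle (A 0) (A 2 - A 0) (A 3 - A 0).
Proof.
move=> /convex_ccw_det[d012 d023 d013 d123]; apply/seteqP; split => x.
  move=> [t [t0 t1 ->]]; rewrite sum_ord4 in t1; rewrite sum_ord4.
  set l3 := det2 _ _ in d012; set l1 := det2 _ _ in d023.
  set l2 := det2 _ _ in d013; set l0 := det2 _ _ in d123.
  (* Subtract a multiple of this affine dependency between the vertices until the
     coefficient of A 1 or of A 3 vanishes. *)
  have diag : l0 *: A 0 + l2 *: A 2 = l1 *: A 1 + l3 *: A 3.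
    by apply: eq_plane; rewrite /l0 /l1 /l2 /l3 /det2 !fstsndE; ring.
  have lE : l0 + l2 = l1 + l3 by rewrite /l0 /l1 /l2 /l3 /det2 /=; ring.
  have [le31|lt13] := leP (t 3 / l3) (t 1 / l1).
  - left; pose e := t 3 / l3; have eE : t 3 = e * l3 by rewrite /e divfK // gt_eqF.
    have e0 : 0 <= e by rewrite divr_ge0 // ltW.
    have e1 : e * l1 <= t 1 by rewrite -ler_pdivlMr.
    have -> : t 0 *: A 0 + t 1 *: A 1 + t 2 *: A 2 + t 3 *: A 3 =
        A 0 + (t 1 - e * l1) *: (A 1 - A 0) + (t 2 + e * l2) *: (A 2 - A 0).
      have -> : t 3 *: A 3 = e *: (l0 *: A 0 + l2 *: A 2 - l1 *: A 1).
        by rewrite diag addrC addKr scalerA eE.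
      have t0E : t 0 = 1 - t 1 - t 2 - e * l3 by lra.
      have l0E : l0 = l1 + l3 - l2 by lra.
      by rewrite t0E l0E; apply: eq_plane; rewrite !fstsndE; ring.
    apply: triangle_frame_map; rewrite ?gt_eqF //.
    + by rewrite subr_ge0.
    + by have := t0 2; have := mulr_ge0 e0 (ltW d013); lra.
    + have := mulr_ge0 e0 (ltW d123).
      have := t0 0; have : e * l2 = e * l1 + e * l3 - e * l0 by rewrite -mulrDr -lE; ring.
      by rewrite -eE; lra.
  - right; pose e := t 1 / l1; have eE : t 1 = e * l1 by rewrite /e divfK // gt_eqF.
    have e0 : 0 <= e by rewrite divr_ge0 // ltW.
    have e1 : e * l3 <= t 3 by rewrite -ler_pdivlMr // ltW.
    have -> : t 0 *: A 0 + t 1 *: A 1 + t 2 *: A 2 + t 3 *: A 3 =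
        A 0 + (t 2 + e * l2) *: (A 2 - A 0) + (t 3 - e * l3) *: (A 3 - A 0).
      have -> : t 1 *: A 1 = e *: (l0 *: A 0 + l2 *: A 2 - l3 *: A 3).
        by rewrite diag addrK scalerA eE.
      have t0E : t 0 = 1 - t 3 - t 2 - e * l1 by lra.
      have l0E : l0 = l1 + l3 - l2 by lra.
      by rewrite t0E l0E; apply: eq_plane; rewrite !fstsndE; ring.
    apply: triangle_frame_map; rewrite ?gt_eqF //.
    + by have := t0 2; have := mulr_ge0 e0 (ltW d013); lra.
    + by rewrite subr_ge0.
    + have := mulr_ge0 e0 (ltW d123).
      have := t0 0; have : e * l2 = e * l1 + e * l3 - e * l0 by rewrite -mulrDr -lE; ring.
      by rewrite -eE; lra.
(* Conversely, the frame coordinates of a point of a triangle give convex weights, completed by 0 at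
   the fourth vertex. *)
move=> [] /triangle_frame -/(_ (lt0r_neq0 _)).
- move=> /(_ d012)[y [y1 y2 y12] ->].
  exists (fun k => [:: 1 - y.1 - y.2; y.1; y.2; 0]`_k); rewrite !sum_ord4 /=; split.
  + by elim/ord4_ind => //=; lra.
  + by ring.
  + by apply: eq_plane; rewrite /frame_map !fstsndE /=; ring.
- move=> /(_ d023)[y [y1 y2 y12] ->].
  exists (fun k => [:: 1 - y.1 - y.2; 0; y.1; y.2]`_k); rewrite !sum_ord4 /=; split.
  + by elim/ord4_ind => //=; lra.
  + by ring.
  + by apply: eq_plane; rewrite /frame_map !fstsndE /=; ring.
Qed.

(** This adds the vertex rules of the two triangles of [cell_triangles]. Their overlap lies on both
    sides of the diagonal, hence on its line, which is null. *)
Lemma Rintegral_cell A (a b c : R) (f := affine_form a b c) : convex_ccw A ->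
  \int[area R]_(x in cell A) f x =
  (det2 (A 1 - A 0) (A 2 - A 0) * (f (A 0) + f (A 1) + f (A 2)) +
   det2 (A 2 - A 0) (A 3 - A 0) * (f (A 0) + f (A 2) + f (A 3))) / 6.
Proof.
move=> cA; have [d012 d023 _ _] := convex_ccw_det cA; rewrite (cell_triangles cA).
set T1 := triangle _ _ _; set T2 := triangle _ _ _.
have mT1 : measurable T1 by exact: measurable_triangle.
have mT2 : measurable T2 by exact: measurable_triangle.
have mI : measurable (T1 `&` T2) by exact: measurableI.
have mD : measurable (T2 `\` T1) by exact: measurableD.
have I0 : area R (T1 `&` T2) = 0%E.
  have u0 : A 2 - A 0 != 0 by apply: contraTneq d012 => ->; rewrite /det2 /= !mulr0 subrr ltxx.
  apply/eqP; rewrite eq_le measure_ge0 andbT -(area_line (A 0) u0).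
  apply: le_measure; rewrite ?inE //.
    exact: measurable_line.
  move=> x [/(triangle_frame (lt0r_neq0 d012))[y [y1 y2 _] yE]].
  move=> /(triangle_frame (lt0r_neq0 d023))[z [z1 z2 _] zE].
  apply/eqP; rewrite eq_le; apply/andP; split.
    have -> : det2 (A 2 - A 0) (x - A 0) = - (y.1 * det2 (A 1 - A 0) (A 2 - A 0)).
      by rewrite yE /frame_map /det2 /=; ring.
    by rewrite oppr_le0 mulr_ge0 // ltW.
  have -> : det2 (A 2 - A 0) (x - A 0) = z.2 * det2 (A 2 - A 0) (A 3 - A 0).
    by rewrite zE /frame_map /det2 /=; ring.
  by rewrite mulr_ge0 // ltW.
have i1 : (area R).-integrable T1 (EFin \o f) by apply: integrable_triangle; rewrite gt_eqF.
have i2 : (area R).-integrable T2 (EFin \o f) by apply: integrable_triangle; rewrite gt_eqF.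
have iD : (area R).-integrable (T2 `\` T1) (EFin \o f) by apply: integrableS i2.
have E2 : \int[area R]_(x in T2) f x = \int[area R]_(x in T2 `\` T1) f x.
  rewrite /Rintegral (negligible_integral mI mT2 i2 I0); congr fine.
  by rewrite setDIr setDv setU0.
have iU : (area R).-integrable (T1 `|` T2) (EFin \o f).
  have [M1 TM1] := triangle_bounded (A 0) (lt0r_neq0 d012).
  have [M2 TM2] := triangle_bounded (A 0) (lt0r_neq0 d023).
  apply: (integrable_affine_form (M := Num.max M1 M2)); first exact: measurableU.
    have : (area R (T1 `|` T2) <= area R T1 + area R T2)%E.
      exact: (measureU2 (area R) mT1 mT2).
    by move=> /le_lt_trans; apply; rewrite !area_triangle ?gt_eqF // -EFinD ltry.
  by move=> x [/TM1[]|/TM2[]]; rewrite !le_max => -> ->; rewrite ?orbT.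
have UE : T1 `|` T2 = T1 `|` (T2 `\` T1).
  apply/seteqP; split => x [T1x|]; [by left| |by left|by case; right].
  by case: (pselect (T1 x)); [left | right].
rewrite UE in iU *.
have disj : [disjoint T1 & T2 `\` T1] by apply/disj_setPS => x [T1x [_ /(_ T1x)]].
apply: (etrans (Rintegral_setU mT1 mD iU disj)).
rewrite -E2 !Rintegral_triangle ?gt_eqF // !(gtr0_norm d012, gtr0_norm d023).
by rewrite !subrKC -/f; ring.
Qed.

End CellGeometry.

(** * Integrals over cells of derivatives of QBL functions *)

Section Derivatives.
Context {R : realType}.
Implicit Types (A : 'I_4 -> R * R) (x v g : R * R).

(** The difference quotient is exactly [l + h * q]. This covers affine forms and, along any line,
    the functions of [QBL A]. *)
Lemma is_derive_quadratic (f : R * R -> R) x v (l q : R) :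
  (forall h : R, f (h *: v + x) = f x + h * l + h ^+ 2 * q) -> is_derive x v f l.
Proof.
move=> fE; have H : (fun h => h^-1 *: ((f \o shift x) (h *: v) - f x)) @ (0 : R)^' --> l.
  apply: (@cvg_trans _ ((fun h => l + h * q) @ (0 : R)^')).
    apply: near_eq_cvg; near=> h.
    have h0 : h != 0 by near: h; exact: nbhs_dnbhs_neq.
    by rewrite /= fE /GRing.scale /=; field.
  have : (fun h : R => l + h * q) @ nbhs 0 --> l + 0 * q.
    by apply: cvgD; [exact: cvg_cst | apply: cvgM; [exact: cvg_id | exact: cvg_cst]].
  rewrite mul0r addr0; apply: cvg_trans; apply: cvg_app; exact: cvg_within.
by split; [exact: cvgP H | exact: cvg_lim H].
Unshelve. all: by end_near. Qed.

Lemma is_derive_affine_form (a b c : R) x v :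
  is_derive x v (affine_form a b c) (b * v.1 + c * v.2).
Proof.
apply: (@is_derive_quadratic _ _ _ _ 0) => h.
by rewrite /affine_form !fstsndE; ring.
Qed.

Lemma partial_affine_form (a b c : R) (i : bool) :
  partial i (affine_form a b c) = affine_form (if i then c else b) 0 0.
Proof.
apply/funext => x; rewrite /partial.
rewrite (derive_val (is_derive := is_derive_affine_form a b c x (basis_vec i))).
by case: i; rewrite /affine_form /=; ring.
Qed.

Lemma partials_affine_form (a b c : R) (s : seq bool) :
  exists a' b' c', partials s (affine_form a b c) = affine_form a' b' c'.
Proof.
elim: s => [|i s [a' [b' [c' IHs]]]]; first by exists a, b, c.
by exists (if i then c' else b'), 0, 0; rewrite /= -/(partials s _) IHs partial_affine_form.
Qed.

Lemma continuous_affine_form (a b c : R) : continuous (affine_form a b c).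
Proof.
move=> x; apply: cvgD; first (apply: cvgD; first exact: cvg_cst).
  by apply: cvgM; [exact: cvg_cst | exact: cvg_fst].
by apply: cvgM; [exact: cvg_cst | exact: cvg_snd].
Qed.

Lemma smooth_affine_form (a b c : R) G : smooth_on G (affine_form a b c).
Proof.
exists setT; split => [|//|s x _]; first exact: openT.
have [a' [b' [c' ->]]] := partials_affine_form a b c s; split.
  by move=> i; have [] := is_derive_affine_form a' b' c' x (basis_vec i).
exact: continuous_affine_form.
Qed.

Lemma laplacian_affine_form (a b c : R) x : laplacian (affine_form a b c) x = 0.
Proof.
rewrite /laplacian big1 // => i _; rewrite !partial_affine_form /affine_form.
by case: i; ring.
Qed.

End Derivatives.

Section CellContribution.
Context {R : realType}.
Implicit Types (A : 'I_4 -> R * R) (x v g : R * R).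

(** The linear parts of [xi] and [eta], that is, their derivatives in the direction [v]. *)
Definition dxi A v : R := det2 v (svec A) / det2 (rvec A) (svec A).
Definition deta A v : R := det2 (rvec A) v / det2 (rvec A) (svec A).

Lemma xiD A x v (h : R) : xi A (h *: v + x) = xi A x + h * dxi A v.
Proof. by rewrite /xi /dxi /det2 !fstsndE; ring. Qed.

Lemma etaD A x v (h : R) : eta A (h *: v + x) = eta A x + h * deta A v.
Proof. by rewrite /eta /deta /det2 !fstsndE; ring. Qed.

Lemma dxi_lin A g : dxi A g = g.1 * dxi A (1, 0) + g.2 * dxi A (0, 1).
Proof. by rewrite /dxi /det2 /=; ring. Qed.

Lemma deta_lin A g : deta A g = g.1 * deta A (1, 0) + g.2 * deta A (0, 1).
Proof. by rewrite /deta /det2 /=; ring. Qed.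

Lemma grad_dot_QBL A g (a b c d : R) x :
  grad_dot (affine_form 0 g.1 g.2)
    (fun x => a + b * xi A x + c * eta A x + d * (xi A x * eta A x)) x
  = b * dxi A g + c * deta A g + d * (dxi A g * eta A x + deta A g * xi A x).
Proof.
set p := fun x => _.
have Dp v : 'D_v p x = b * dxi A v + c * deta A v + d * (dxi A v * eta A x + deta A v * xi A x).
  suff H : is_derive x v p
      (b * dxi A v + c * deta A v + d * (dxi A v * eta A x + deta A v * xi A x)).
    by rewrite (derive_val (is_derive := H)).
  apply: (@is_derive_quadratic _ _ _ _ _ (d * (dxi A v * deta A v))) => h.
  by rewrite /p xiD etaD; ring.
rewrite /grad_dot big_bool /= !partial_affine_form /partial !Dp /affine_form /basis_vec /=.
by rewrite (dxi_lin A g) (deta_lin A g); ring.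
Qed.

Lemma local_coords A x : convex_ccw A ->
  x = Defs.center A + xi A x *: rvec A + eta A x *: svec A.
Proof.
move=> /det2_rs_gt0 /lt0r_neq0; rewrite /xi /eta.
move: (Defs.center A) (rvec A) (svec A) => c r s d0.
by apply: eq_plane; rewrite !fstsndE; move: d0; rewrite /det2 !fstsndE => d0; field.
Qed.

Lemma det2_local A P Q S : convex_ccw A -> det2 (P - Q) (S - Q) =
  ((xi A P - xi A Q) * (eta A S - eta A Q) - (xi A S - xi A Q) * (eta A P - eta A Q))
  * det2 (rvec A) (svec A).
Proof.
move=> cA; rewrite {1}(local_coords P cA) {1 2}(local_coords Q cA) {1}(local_coords S cA).
move: (Defs.center A) (rvec A) (svec A) (xi A P) (xi A Q) (xi A S) (eta A P) (eta A Q) (eta A S).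
by move=> c r s *; rewrite /det2 !fstsndE; ring.
Qed.

Definition bias A : R * R := alpha A *: svec A - beta A *: rvec A.

(* By bilinear_interpolation, the coefficient of xi * eta in the function of QBL A
   with value 1 at A 0 and 0 at the other vertices. *)
Definition twist A : R := (1 - alpha A - beta A) / (4 * (1 - alpha A ^+ 2 - beta A ^+ 2)).

Lemma shape_parameters_sqr (al be : R) : `|al| + `|be| < 1 -> 0 < 1 - al ^+ 2 - be ^+ 2.
Proof.
move=> ab1; have := ler_norm al; have := ler_norm (- al).
by have := ler_norm be; have := ler_norm (- be); rewrite !normrN => *; nra.
Qed.

(** The reference form of interpolation at the four vertices, with value [V] at the first and 0 at
    the others. Once [d] is known, signed sums of the four equations give [a], [b] and [c]. *)
Lemma bilinear_interpolation (a b c d al be V : R)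
    (P := fun s t : R => a + b * s + c * t + d * (s * t)) :
  `|al| + `|be| < 1 -> P (1 + al) (1 + be) = V -> P (- 1 - al) (1 - be) = 0 ->
  P (- 1 + al) (- 1 + be) = 0 -> P (1 - al) (- 1 - be) = 0 ->
  [/\ a = V / 4 - al * be * d, b = V / 4 - al * d, c = V / 4 - be * d &
      d = V * ((1 - al - be) / (4 * (1 - al ^+ 2 - be ^+ 2)))].
Proof.
move=> ab1 e0 e1 e2 e3; have q0 : 1 - al ^+ 2 - be ^+ 2 != 0.
  exact: lt0r_neq0 (shape_parameters_sqr ab1).
have dE : d * (4 * (1 - al ^+ 2 - be ^+ 2)) = V * (1 - al - be).
  (* These weights form the affine dependency of the four vertices: they annihilate 1, [s] and [t],
     and only the [s * t] term survives. *)
  transitivity (P (1 + al) (1 + be) * (1 - al - be) + P (- 1 - al) (1 - be) * (- 1 + al - be)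
      + P (- 1 + al) (- 1 + be) * (1 + al + be) + P (1 - al) (- 1 - be) * (- 1 - al + be)).
    by rewrite /P; ring.
  by rewrite e0 e1 e2 e3 !mul0r !addr0.
split; last by rewrite mulrA -dE mulfK // mulf_neq0.
- by move: e0 e1 e2 e3; rewrite /P; lra.
- by move: e0 e1 e2 e3; rewrite /P; lra.
- by move: e0 e1 e2 e3; rewrite /P; lra.
Qed.

(** The integrand is affine, so [Rintegral_cell] reduces the integral to vertex values; these are
    explicit in the shape parameters, and interpolation supplies the coefficients of [p]. *)
Lemma Rintegral_grad_cell A (p : R * R -> R) g : convex_ccw A -> QBL A p ->
  p (A 1) = 0 -> p (A 2) = 0 -> p (A 3) = 0 ->
  \int[area R]_(x in cell A) grad_dot (affine_form 0 g.1 g.2) p x =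
  p (A 0) * (det2 g (A 1 - A 3) / 2 - 8 / 3 * twist A * det2 g (bias A)).
Proof.
move=> cA [a [b [c [d pE]]]] p1 p2 p3.
have d0 := lt0r_neq0 (det2_rs_gt0 cA).
have [[x0 y0] [x1 y1] [x2 y2] [x3 y3] ab1] := vertex_coords cA.
pose f x := b * dxi A g + c * deta A g + d * (dxi A g * eta A x + deta A g * xi A x).
pose f0 := f (0, 0); pose f1 := d * (dxi A g * deta A (1, 0) + deta A g * dxi A (1, 0)).
pose f2 := d * (dxi A g * deta A (0, 1) + deta A g * dxi A (0, 1)).
have fE x : f x = affine_form f0 f1 f2 x.
  have E : x = 1 *: x + (0, 0) by apply: eq_plane; rewrite !fstsndE /=; ring.
  rewrite /affine_form /f1 /f2 /f0 /f {1 2}E xiD etaD (dxi_lin A x) (deta_lin A x).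
  by ring.
transitivity (\int[area R]_(x in cell A) affine_form f0 f1 f2 x).
  by apply: eq_Rintegral => x _; rewrite pE grad_dot_QBL -fE.
apply: (etrans (Rintegral_cell _ _ _ cA)).
rewrite -!fE (det2_local (A 1) (A 0) (A 2) cA) (det2_local (A 2) (A 0) (A 3) cA).
rewrite /f x0 x1 x2 x3 y0 y1 y2 y3.
have E13 : det2 g (A 1 - A 3) / 2 = det2 (rvec A) (svec A) * (dxi A g + deta A g).
  (* The shape parameters cancel along this diagonal. *)
  have -> : A 1 - A 3 = 2 *: (svec A - rvec A).
    rewrite {1}(local_coords (A 1) cA) {1}(local_coords (A 3) cA) x1 x3 y1 y3.
    by apply: eq_plane; rewrite !fstsndE; ring.
  move: d0; rewrite /dxi /deta; move: (rvec A) (svec A) => r s d0.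
  have DK z : det2 r s * (z / det2 r s) = z by rewrite mulrC divfK.
  by rewrite mulrDr !DK /det2 !fstsndE; field.
have Esk : det2 g (bias A) = det2 (rvec A) (svec A) * (alpha A * dxi A g + beta A * deta A g).
  rewrite /bias; move: d0; rewrite /dxi /deta; move: (rvec A) (svec A) => r s d0.
  have DK k z : det2 r s * (k * (z / det2 r s)) = k * z by rewrite mulrCA [det2 r s * _]mulrC divfK.
  by rewrite mulrDr !DK /det2 !fstsndE; ring.
rewrite E13 Esk.
move: p1 p2 p3 (erefl (p (A 0))); rewrite {1 2 3 4}pE x0 x1 x2 x3 y0 y1 y2 y3 => p1 p2 p3 p0.
have [_ -> -> ->] := bilinear_interpolation ab1 p0 p1 p2 p3; rewrite -/(twist A).
by field.
Qed.

Lemma QBL_eq0 A (p : R * R -> R) : convex_ccw A -> QBL A p ->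
  p (A 0) = 0 -> p (A 1) = 0 -> p (A 2) = 0 -> p (A 3) = 0 -> p = cst 0.
Proof.
move=> cA [a [b [c [d pE]]]].
have [[x0 y0] [x1 y1] [x2 y2] [x3 y3] ab1] := vertex_coords cA.
rewrite !pE x0 x1 x2 x3 y0 y1 y2 y3 => p0 p1 p2 p3.
have [-> -> -> ->] := bilinear_interpolation ab1 p0 p1 p2 p3.
by apply/funext => x /=; rewrite !(mul0r, mulr0, subr0, addr0).
Qed.

End CellContribution.

(** * Interiors of cells and the geometry of the patch *)

Section CellTopology.
Context {R : realType}.
Implicit Types (A B : 'I_4 -> R * R) (P Q S T w : R * R).

Lemma cell_vertex A k : cell A (A k).
Proof.
exists (fun j => (j == k)%:R); split.
- by move=> j; rewrite ler0n.
- by rewrite (bigD1 k) //= eqxx big1 ?addr0 // => j /negbTE ->.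
- by rewrite (bigD1 k) //= eqxx scale1r big1 ?addr0 // => j /negbTE ->; rewrite scale0r.
Qed.

Lemma cell_convex A P Q S (s t : R) : cell A P -> cell A Q -> cell A S ->
  0 <= s -> 0 <= t -> s + t <= 1 -> cell A (P + s *: (Q - P) + t *: (S - P)).
Proof.
move=> [a [a0 a1 ->]] [b [b0 b1 ->]] [c [c0 c1 ->]] s0 t0 st.
exists (fun k => (1 - s - t) * a k + s * b k + t * c k); split.
- by move=> k; rewrite !addr_ge0 // mulr_ge0 //; lra.
- by rewrite !big_split /= -!mulr_sumr a1 b1 c1; ring.
- rewrite [RHS](_ : _ = (1 - s - t) *: \sum_k a k *: A k + s *: \sum_k b k *: A k +
      t *: \sum_k c k *: A k).
    by apply: eq_plane; rewrite !fstsndE; ring.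
  rewrite !scaler_sumr -!big_split /=; apply: eq_bigr => k _.
  by rewrite !scalerA -!scalerDl.
Qed.

Lemma cell_halfplane A (a b c : R) : (forall k, 0 <= affine_form a b c (A k)) ->
  forall w, cell A w -> 0 <= affine_form a b c w.
Proof.
move=> Age0 _ [t [t0 t1 ->]].
have -> : affine_form a b c (\sum_k t k *: A k) = \sum_k t k * affine_form a b c (A k).
  move: t1; rewrite !sum_ord4 /affine_form !fstsndE => t1.
  have aE : a = a * (t 0 + t 1 + t 2 + t 3) by rewrite t1 mulr1.
  by rewrite {1}aE; ring.
by apply: sumr_ge0 => k _; rewrite mulr_ge0.
Qed.

(** The coordinates [l1], [l2] of a point in the frame of the triangle are continuous, so the strict
    inequalities persist nearby, and convexity keeps the nearby points in the cell. *)
Lemma interior_cell A P Q S (s t : R) : cell A P -> cell A Q -> cell A S ->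
  det2 (Q - P) (S - P) != 0 -> 0 < s -> 0 < t -> s + t < 1 ->
  (cell A)° (P + s *: (Q - P) + t *: (S - P)).
Proof.
move=> AP AQ AS d0 s0 t0 st; set u := Q - P; set v := S - P; set d := det2 u v.
pose l1 := affine_form ((P.2 * v.1 - P.1 * v.2) / d) (v.2 / d) (- v.1 / d).
pose l2 := affine_form ((P.1 * u.2 - P.2 * u.1) / d) (- u.2 / d) (u.1 / d).
have l1E x : l1 x = det2 (x - P) v / d by rewrite /l1 /affine_form /det2 !fstsndE; ring.
have l2E x : l2 x = det2 u (x - P) / d by rewrite /l2 /affine_form /det2 !fstsndE; ring.
have xE x : x = P + l1 x *: u + l2 x *: v.
  rewrite l1E l2E; apply: eq_plane; rewrite !fstsndE; move: d0;
    by rewrite -/u -/v /d /det2 !fstsndE => d0; field.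
have l1w : l1 (P + s *: u + t *: v) = s.
  by rewrite l1E; move: d0; rewrite -/u -/v /d /det2 !fstsndE => d0; field.
have l2w : l2 (P + s *: u + t *: v) = t.
  by rewrite l2E; move: d0; rewrite -/u -/v /d /det2 !fstsndE => d0; field.
set w := P + _ + _; rewrite /interior /=; near=> x.
have x1 : 0 < l1 x.
  near: x; apply: (@cvgr_gt _ _ _ _ l1 (l1 w)); first exact: continuous_affine_form.
  by rewrite l1w.
have x2 : 0 < l2 x.
  near: x; apply: (@cvgr_gt _ _ _ _ l2 (l2 w)); first exact: continuous_affine_form.
  by rewrite l2w.
have x12 : l1 x + l2 x < 1.
  near: x; apply: (@cvgr_lt _ _ _ _ (fun x => l1 x + l2 x) (l1 w + l2 w)).
    by apply: cvgD; exact: continuous_affine_form.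
  by rewrite l1w l2w.
by rewrite (xE x); apply: cell_convex => //; apply: ltW.
Unshelve. all: by end_near. Qed.

Lemma nbhs_ray w (v : R * R) (N : set (R * R)) : nbhs w N ->
  \forall e \near (0 : R)^'+, N (w + e *: v).
Proof.
move=> Nw; have : (fun e : R => w + e *: v) @ nbhs 0 --> w + 0 *: v.
  apply: cvgD; [exact: cvg_cst | apply: cvgZ; [exact: cvg_id | exact: cvg_cst]].
rewrite scale0r addr0 => /(_ _ Nw) H.
have {}H : \forall e \near nbhs (0 : R), N (w + e *: v) by exact: H.
by rewrite near_withinE; near=> e => _; near: e.
Unshelve. all: by end_near. Qed.

(** With [P], [Q] in [B] not collinear with [w], a small move from [w] towards both enters the open
    triangle [w], [P], [Q] without leaving the interior of the cell of [A]. *)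
Lemma interior_cell_meets A B w : convex_ccw B -> (cell A)° w -> cell B w ->
  exists y, (cell A)° y /\ (cell B)° y.
Proof.
move=> /convex_ccw_det[d012 _ _ _] Aw Bw.
(* The determinants of the three vertex pairs, taken in cyclic order as seen from [w], add up to
   [det2 (B 1 - B 0) (B 2 - B 0) > 0], so they cannot all vanish. *)
have [P [Q [BP BQ d0]]] : exists P Q, [/\ cell B P, cell B Q & det2 (P - w) (Q - w) != 0].
  have [d01|d01] := eqVneq (det2 (B 0 - w) (B 1 - w)) 0; last first.
    by exists (B 0), (B 1); split => //; exact: cell_vertex.
  have [d12|d12] := eqVneq (det2 (B 1 - w) (B 2 - w)) 0; last first.
    by exists (B 1), (B 2); split => //; exact: cell_vertex.
  exists (B 2), (B 0); split; [exact: cell_vertex | exact: cell_vertex |].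
  apply: lt0r_neq0; move: d012 d01 d12; rewrite /det2 !fstsndE; lra.
have [e [[e0 e1] eA]] : exists e : R,
    (0 < e /\ e < 2^-1) /\ (cell A)° (w + e *: ((P - w) + (Q - w))).
  apply: (@filter_ex _ (0 : R)^'+); near=> e; split; first split.
  - by near: e; exact: nbhs_right_gt.
  - by near: e; apply: nbhs_right_lt; rewrite invr_gt0.
  - by near: e; apply: nbhs_ray; apply: open_nbhs_nbhs; split => //; exact: open_interior.
exists (w + e *: ((P - w) + (Q - w))); split => //.
by rewrite scalerDr addrA; apply: interior_cell => //; lra.
Unshelve. all: by end_near. Qed.

Lemma det2_decomposition (u v w : R * R) : det2 u w != 0 ->
  v = (det2 v w / det2 u w) *: u + (det2 u v / det2 u w) *: w.
Proof.
by move=> d0; apply: eq_plane; rewrite !fstsndE; move: d0; rewrite /det2 => d0; field.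
Qed.

(** Two triangles on a common side [P], [Q] and on the same side of it overlap just above the
    midpoint of that side. *)
Lemma same_side_meet A B P Q S T :
  cell A P -> cell A Q -> cell A S -> cell B P -> cell B Q -> cell B T ->
  0 < det2 (Q - P) (S - P) * det2 (Q - P) (T - P) ->
  exists y, (cell A)° y /\ (cell B)° y.
Proof.
move=> AP AQ AS BP BQ BT; set u := Q - P; set v := S - P; set v' := T - P => dd.
have d0 : det2 u v != 0 by apply: contraTneq dd => ->; rewrite mul0r ltxx.
have d'0 : det2 u v' != 0 by apply: contraTneq dd => ->; rewrite mulr0 ltxx.
pose a := det2 v v' / det2 u v'; pose b := det2 u v / det2 u v'.
have b0 : 0 < b.
  have -> : b = det2 u v * det2 u v' / det2 u v' ^+ 2 by rewrite /b; field.
  by rewrite divr_gt0 // exprn_even_gt0.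
have vE : v = a *: u + b *: v'.
  exact: det2_decomposition.
(* With this choice [e], [e * |a|] and [e * b] add up to 1/4, so that the coordinates 1/2 and [e] in
   one frame, and [1/2 + e * a] and [e * b] in the other, satisfy the strict triangle
   inequalities. *)
pose k := 1 + `|a| + b; have k0 : 0 < k by rewrite /k; have := normr_ge0 a; lra.
pose e := (4 * k)^-1; have e0 : 0 < e by rewrite invr_gt0; lra.
have ek : e * k = 4^-1 by rewrite /e; field; rewrite gt_eqF.
have eb : 0 < e * b by rewrite mulr_gt0.
have := mulr_ge0 (ltW e0) (normr_ge0 a).
have [h1 h2] : e * a <= e * `|a| /\ - (e * a) <= e * `|a|.
  by rewrite -mulrN !ler_pM2l // ler_norm -normrN ler_norm.
move: ek; rewrite /k !mulrDr => ek ?.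
exists (P + 2^-1 *: u + e *: v); split; first by apply: interior_cell => //; lra.
rewrite (_ : _ + _ = P + (2^-1 + e * a) *: u + (e * b) *: v'); last first.
  by rewrite vE; apply: eq_plane; rewrite !fstsndE; ring.
by apply: interior_cell => //; lra.
Qed.

End CellTopology.

(** * Effect of renumbering on local coordinates and shape parameters *)

Section Relabelling.
Context {R : realType}.
Implicit Types (A : 'I_4 -> R * R).

Lemma relabel_ind (P : ('I_4 -> R * R) -> Prop) : (forall A, P A -> P (relabel A 1)) ->
  forall A k, P A -> P (relabel A k).
Proof.
move=> Prelabel A k PA; elim/ord4_ind: k.
- by rewrite (_ : relabel A 0 = A) //; apply/funext => j; rewrite /relabel add0r.
- exact: Prelabel.
- have := Prelabel _ (Prelabel _ PA); congr P; apply/funext => j.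
  by rewrite /relabel addrA ord4D.
- have := Prelabel _ (Prelabel _ (Prelabel _ PA)); congr P; apply/funext => j.
  by rewrite /relabel !addrA !ord4D.
Qed.

Lemma relabel1_local A : [/\ Defs.center (relabel A 1) = Defs.center A,
  rvec (relabel A 1) = svec A & svec (relabel A 1) = - rvec A].
Proof.
split; apply: eq_plane; rewrite /rvec /svec /Defs.center /medge /midpoint;
  by rewrite !ord4D !relabel1E !fstsndE; lra.
Qed.

Lemma QBL_relabel A k p : QBL A p -> QBL (relabel A k) p.
Proof.
pose P B := QBL B p; rewrite -/(P A) -/(P (relabel A k)); apply: relabel_ind => {A k} A.
(* A rotation by one index replaces the coordinates [xi], [eta] by [eta], [- xi]; the coefficients
   change accordingly. *)
move=> [a [b [c [d pE]]]]; exists a, c, (- b), (- d); rewrite pE; apply/funext => x.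
have [ctrE rE sE] := relabel1_local A.
have -> : xi (relabel A 1) x = eta A x.
  by rewrite /xi /eta ctrE rE sE /det2 !fstsndE; congr (_ / _); ring.
have -> : eta (relabel A 1) x = - xi A x.
  by rewrite /xi /eta ctrE rE sE -mulNr /det2 !fstsndE; congr (_ / _); ring.
by ring.
Qed.

Lemma rsvec_free A (a b : R) : convex_ccw A -> a *: rvec A + b *: svec A = 0 -> a = 0 /\ b = 0.
Proof.
move=> cA ab0; have [xa yb] := local_coordsK a b cA; have [x0 y0] := local_coordsK 0 0 cA.
have zE : Defs.center A + a *: rvec A + b *: svec A =
    Defs.center A + 0 *: rvec A + 0 *: svec A.
  by rewrite -addrA ab0 !scale0r !addr0.
by move: xa yb; rewrite zE x0 y0 => <- <-.
Qed.

(** This vector vanishes exactly for parallelograms, and a rotation of the numbering by one index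
    only changes its sign. In local terms it is four times
    [alpha A *: rvec A + beta A *: svec A]. *)
Definition defect A : R * R := A 0 - A 1 + A 2 - A 3.

Lemma defect_eq0 A : convex_ccw A -> defect A = 0 <-> alpha A = 0 /\ beta A = 0.
Proof.
move=> cA; have [[x0 y0] [x1 y1] [x2 y2] [x3 y3] _] := vertex_coords cA.
have -> : defect A = (4 * alpha A) *: rvec A + (4 * beta A) *: svec A.
  rewrite /defect (local_coords (A 0) cA) (local_coords (A 1) cA).
  rewrite (local_coords (A 2) cA) (local_coords (A 3) cA) x0 x1 x2 x3 y0 y1 y2 y3.
  by apply: eq_plane; rewrite !fstsndE; ring.
split=> [/(rsvec_free cA)[]|[-> ->]]; last by rewrite !mulr0 !scale0r addr0.
by split; lra.
Qed.

Lemma bias_eq0 A : convex_ccw A -> bias A = 0 <-> alpha A = 0 /\ beta A = 0.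
Proof.
move=> cA; have -> : bias A = (- beta A) *: rvec A + alpha A *: svec A.
  by rewrite /bias addrC scaleNr.
split=> [/(rsvec_free cA)[]|[-> ->]]; last by rewrite oppr0 !scale0r addr0.
by split; lra.
Qed.

(** [bias] and [defect] vanish together, and for [defect] the invariance under renumbering is
    visible. *)
Lemma bias_relabel_eq0 A k : convex_ccw A -> bias (relabel A k) = 0 <-> alpha A = 0 /\ beta A = 0.
Proof.
move=> cA; apply: iff_trans (bias_eq0 (convex_ccw_relabel k cA)) _.
apply: iff_trans (iff_sym (defect_eq0 (convex_ccw_relabel k cA))) _.
apply: iff_trans _ (defect_eq0 cA).
have D1 B : defect (relabel B 1) = - defect B.
  by rewrite /defect !relabel1E; apply: eq_plane; rewrite !fstsndE; ring.
pose P B := defect B = 0 <-> defect A = 0; rewrite -/(P (relabel A k)).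
apply: relabel_ind => [B|]; last by [].
rewrite /P D1 => <-; split => [/eqP|->]; last by rewrite oppr0.
by rewrite oppr_eq0 => /eqP.
Qed.

Lemma convex_ccw_vertex A k : convex_ccw A -> A k = A 0 -> k = 0.
Proof.
have d0l (w : R * R) : ~ 0 < det2 (A 0 - A 0) w by rewrite subrr /det2 !mul0r subrr ltxx.
have d0r (w : R * R) : ~ 0 < det2 w (A 0 - A 0) by rewrite subrr /det2 !mulr0 subrr ltxx.
move=> /convex_ccw_det[d012 d023 d013 _]; elim/ord4_ind: k => // E; exfalso.
- by move: d012; rewrite E => /d0l.
- by move: d023; rewrite E => /d0l.
- by move: d013; rewrite E => /d0r.
Qed.

Lemma is_edge_vertex0 A P : convex_ccw A -> is_edge A (A 0) P -> P = A 1 \/ P = A 3.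
Proof.
move=> cA [k [] [kE lE]].
- by left; rewrite -lE (convex_ccw_vertex cA kE) ord4D.
- right; rewrite -kE; congr A; apply: (addIr 1).
  by rewrite (convex_ccw_vertex cA lE) ord4D.
Qed.

End Relabelling.

(** * Edges that lie on the boundary of the patch *)

Section PatchGeometry.
Context {R : realType}.
Implicit Types (D P : R * R).

Context (K : 'I_4 -> 'I_4 -> R * R).
Context (convK : forall i, convex_ccw (K i)).
Context (disjK : forall i j, i != j -> (cell (K i))° `&` (cell (K j))° = set0).

(** Disjointness of interiors is strengthened: the interior of one cell misses every other cell
    entirely, including its boundary. *)
Lemma interior_cell_disjoint i j w : (cell (K i))° w -> cell (K j) w -> i = j.
Proof.
move=> iw jw; apply/eqP/negPn/negP => ij.
have [y yij] := interior_cell_meets (convK j) iw jw.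
by have : set0 y by rewrite -(disjK ij).
Qed.

(* A point of the open edge is interior to the patch only if a cell continues
   beyond it; by convexity that cell contains the segment back to D, which runs
   through the interior of the i-th cell. *)
Lemma boundary_segment D i m n : (forall j, cell (K j) D) ->
  boundary (patch_domain K) (K i m) -> boundary (patch_domain K) (K i n) ->
  (forall k, 0 <= det2 (K i n - K i m) (K i k - K i m)) ->
  0 < det2 (K i n - K i m) (D - K i m) ->
  segment (K i m) (K i n) `<=` boundary (patch_domain K).
Proof.
move=> KD bm bn half Dpos x [t]; rewrite /= in_itv /= => /andP[t0 t1] xE.
have [t00|t00] := eqVneq t 0; first by rewrite -xE t00 subr0 scale1r scale0r addr0.
have [t11|t11] := eqVneq t 1; first by rewrite -xE t11 subrr scale1r scale0r add0r.
have {}t0 : 0 < t by rewrite lt_neqAle eq_sym t00.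
have {}t1 : t < 1 by rewrite lt_neqAle t11.
have vertK := @cell_vertex R (K i).
have ix : cell (K i) x.
  have := cell_convex (vertK m) (vertK n) (vertK m) (ltW t0) (lexx 0) _.
  rewrite addr0 => /(_ (ltW t1)); congr (cell (K i)).
  by rewrite -xE; apply: eq_plane; rewrite !fstsndE; ring.
split; first by apply: subset_closure; exists i.
move=> intx; have [e [e0 [j _ ej]]] : exists e : R, 0 < e /\ patch_domain K (x + e *: (x - D)).
  apply: (@filter_ex _ (0 : R)^'+); near=> e; split.
    by near: e; exact: nbhs_right_gt.
  by near: e; apply: nbhs_ray.
have ij : i = j.
  (* [w] is the midpoint of [D] and [x], an inner point of the triangle formed by [D] and the
     edge. *)
  pose w := D + ((1 - t) / 2) *: (K i m - D) + (t / 2) *: (K i n - D).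
  apply: (@interior_cell_disjoint _ _ w).
    apply: interior_cell => //; rewrite ?divr_gt0 ?subr_gt0 //; last by lra.
    by apply: lt0r_neq0; move: Dpos; rewrite /det2 !fstsndE; lra.
  (* The point beyond the edge is [D + (1 + e) *: (x - D)], so this fraction of the way from [D]
     ends at [w]. *)
  have := cell_convex (KD j) ej (KD j) (s := (2 * (1 + e))^-1) _ (lexx 0) _.
  rewrite addr0 invr_ge0 => /(_ _ _)/wrap[]; first by lra.
    by rewrite invf_le1; lra.
  congr (cell (K j)); rewrite /w -xE; apply: eq_plane; rewrite !fstsndE; field; lra.
(* The point beyond the edge thus belongs to the i-th cell, although it lies strictly on the wrong
   side of the edge line. *)
rewrite -ij in ej; pose u := K i n - K i m.
pose f := affine_form (u.2 * (K i m).1 - u.1 * (K i m).2) (- u.2) u.1.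
have fE z : f z = det2 u (z - K i m) by rewrite /f /affine_form /det2 !fstsndE; ring.
have : 0 <= f (x + e *: (x - D)).
  by apply: cell_halfplane ej => k; rewrite -/(f _) fE; exact: half.
have -> : f (x + e *: (x - D)) = - (e * det2 u (D - K i m)).
  by rewrite fE -xE /u /det2 !fstsndE; ring.
by rewrite oppr_ge0 leNgt mulr_gt0.
Unshelve. all: by end_near. Qed.

End PatchGeometry.

(** * The consistency error *)

(** All matches go the same way round: [X i = Y (i + 1)] followed by [Y (i + 1) = X (i + 2)] would
    contradict injectivity. Hence both sums run over the same points. *)
Lemma sum_cyclic (R : realType) (X Y : 'I_4 -> R * R) :
  injective X -> injective Y -> (forall i, X i = Y (i + 1) \/ Y i = X (i + 1)) ->
  \sum_i X i = \sum_i Y i.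
Proof.
move=> Xinj Yinj XY; have XYs i : X i = Y (i + 1) -> X (i + 1) = Y (i + 1 + 1).
  move=> E; have [//|E'] := XY (i + 1).
  by have := Xinj i (i + 1 + 1); rewrite E E' -addrA => /(_ erefl); elim/ord4_ind: i {E E'}.
have YXs i : Y i = X (i + 1) -> Y (i + 1) = X (i + 1 + 1).
  move=> E; have [E'|//] := XY (i + 1).
  by have := Yinj i (i + 1 + 1); rewrite E E' -addrA => /(_ erefl); elim/ord4_ind: i {E E'}.
rewrite !sum_ord4; have [E0|E0] := XY 0.
  have E1 := XYs _ E0; have E2 := XYs _ E1; have E3 := XYs _ E2.
  rewrite !ord4D in E0 E1 E2 E3; rewrite E0 E1 E2 E3.
  by apply: eq_plane; rewrite !fstsndE; ring.
have E1 := YXs _ E0; have E2 := YXs _ E1; have E3 := YXs _ E2.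
rewrite !ord4D in E0 E1 E2 E3; rewrite E0 E1 E2 E3.
by apply: eq_plane; rewrite !fstsndE; ring.
Qed.

Section NormalizedPatch.
Context {R : realType} (K : 'I_4 -> 'I_4 -> R * R) (D : R * R).
Context (patchK : is_patch K D) (K0 : forall i, K i 0 = D).

Let convK i : convex_ccw (K i). Proof. by case: patchK. Qed.

Let disjK i j : i != j -> (cell (K i))° `&` (cell (K j))° = set0.
Proof. by case: patchK => _ + _ _ _; apply. Qed.

Let cellD i : cell (K i) D. Proof. by rewrite -(K0 i); exact: cell_vertex. Qed.

(* K i 1 and K i 3 are the neighbours of D after and before D in the i-th cell.  Two
   distinct cells cannot share one of them on the same side, so that a shared edge
   is the first one of one cell and the last one of the other. *)
Lemma sum_edges_at_center : \sum_i K i 1 = \sum_i K i 3.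
Proof.
have meet_eq i j (y : R * R) : (cell (K i))° y /\ (cell (K j))° y -> i = j.
  move=> ij; apply/eqP/negPn/negP => /disjK ij0.
  by have : set0 y by rewrite -ij0.
have det_pos i : 0 < det2 (K i 1 - D) (K i 3 - D).
  by rewrite -(K0 i); have [] := convex_ccw_det (convK i).
have vertK i k := @cell_vertex R (K i) k.
have injX : injective (fun i => K i 1).
  move=> i j ij; have [|||||||y] := @same_side_meet R (K i) (K j) D (K i 1) (K i 3) (K j 3) => //.
  - by rewrite ij.
  - by rewrite {2}ij mulr_gt0.
  - exact: meet_eq.
have injY : injective (fun i => K i 3).
  move=> i j ij; have [|||||||y] := @same_side_meet R (K i) (K j) D (K i 3) (K i 1) (K j 1) => //.
  - by rewrite ij.
  - have E (u w : R * R) : det2 u w = - det2 w u by rewrite /det2; ring.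
    by rewrite {2}ij !(E (K _ 3 - D)) mulrNN mulr_gt0.
  - exact: meet_eq.
apply: sum_cyclic => // i; case: patchK => _ _ /(_ i)[P [Pi Pi1]] _ _.
move: Pi Pi1; rewrite -{1}(K0 i) -(K0 (i + 1)) => /(is_edge_vertex0 (convK i)) Pi.
have ii1 : i <> i + 1 by elim/ord4_ind: i {Pi}.
move=> /(is_edge_vertex0 (convK (i + 1))); case: Pi => -> [E|E]; rewrite E; auto.
- by case: ii1; apply: injX.
- by case: ii1; apply: injY.
Qed.

Context (v : R * R -> R) (p : 'I_4 -> R * R -> R) (vV : VQBL0 K v p).

Lemma QBL0_center i : p i D = p 0 D.
Proof.
have step j : p j D = p (j + 1) D.
  case: patchK => _ _ /(_ j)[P [Pj Pj1]] _ _; case: vV => _ _ + _.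
  by move=> /(_ j (j + 1) D P _ Pj Pj1)[] //; elim/ord4_ind: j {Pj Pj1}.
have s1 := step 0; have s2 := step 1; have s3 := step 2; rewrite !ord4D in s1 s2 s3.
by elim/ord4_ind: i => //; rewrite -?s3 -?s2 -?s1.
Qed.

(** Vertices 1, 2 and 3 are the endpoints of the two edges that miss [D]. Both endpoints of such an
    edge lie on the boundary of the patch, and by [boundary_segment] so does the whole edge. *)
Lemma QBL0_boundary i k : k != 0 -> p i (K i k) = 0.
Proof.
move=> k0; have bd j : j != 0 -> boundary (patch_domain K) (K i j).
  move=> j0; case: patchK => _ _ _ _; apply; rewrite -(K0 i) => /(convex_ccw_vertex (convK i)) E.
  by rewrite E eqxx in j0.
have [d012 d023 d013 d123] := convex_ccw_det (convK i).
have Dv : D = K i 0 by [].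
have H m n : m != 0 -> n != 0 -> is_edge (K i) (K i m) (K i n) ->
    (forall k, 0 <= det2 (K i n - K i m) (K i k - K i m)) ->
    0 < det2 (K i n - K i m) (D - K i m) -> p i (K i m) = 0 /\ p i (K i n) = 0.
  move=> m0 n0 emn half Dpos; case: vV => _ _ _; apply => //.
  by apply: (boundary_segment convK disjK cellD) => //; exact: bd.
have [p1 p2] : p i (K i 1) = 0 /\ p i (K i 2) = 0.
  apply: H => //; first by exists 1; left; rewrite ord4D.
    by elim/ord4_ind; move: d012 d123; rewrite /det2 !fstsndE; lra.
  by rewrite Dv; move: d012; rewrite /det2 !fstsndE; lra.
have [_ p3] : p i (K i 2) = 0 /\ p i (K i 3) = 0.
  apply: H => //; first by exists 2; left; rewrite ord4D.
    by elim/ord4_ind; move: d023 d123; rewrite /det2 !fstsndE; lra.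
  by rewrite Dv; move: d023; rewrite /det2 !fstsndE; lra.
by elim/ord4_ind: k k0 => //; rewrite eqxx.
Qed.

(** If the value at [D] were 0, every [p i] would vanish at all four vertices and hence be 0, and
    [v] would be 0 almost everywhere on each of the four cells. *)
Lemma QBL0_center_neq0 : ~ (v = cst 0 %[ae (area R) in patch_domain K]) -> p 0 D != 0.
Proof.
move=> v0; apply/eqP => p0; apply: v0.
have pE i : p i = cst 0.
  case: vV => _ /(_ i)[pQ _] _ _; apply: (QBL_eq0 (convK i) pQ); try exact: QBL0_boundary.
  by rewrite K0 QBL0_center.
have aeE i : \forall x \ae area R, cell (K i) x -> v x = 0.
  by case: vV => _ /(_ i)[_]; rewrite pE.
have F : Filter (almost_everywhere (area R)) by exact: (ae_filter_ringOfSetsType (area R)).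
have [a0 [a1 [a2 a3]]] := conj (aeE 0) (conj (aeE 1) (conj (aeE 2) (aeE 3))).
near=> x; move=> [i _]; elim/ord4_ind: i; near: x.
- exact: a0.
- exact: a1.
- exact: a2.
- exact: a3.
Unshelve. all: by end_near. Qed.

Lemma consistency_error_linear g : (forall i, i != 0 -> bias (K i) = 0) ->
  \sum_(i < 4) (\int[area R]_(x in cell (K i)) grad_dot (affine_form 0 g.1 g.2) (p i) x)
  = - (8 / 3 * p 0 D * twist (K 0) * det2 g (bias (K 0))).
Proof.
move=> bias0; have IE i : \int[area R]_(x in cell (K i)) grad_dot (affine_form 0 g.1 g.2) (p i) x =
    p 0 D * (det2 g (K i 1 - K i 3) / 2 - 8 / 3 * twist (K i) * det2 g (bias (K i))).
  rewrite -(QBL0_center i) -(K0 i); apply: Rintegral_grad_cell => //; try exact: QBL0_boundary.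
  by case: vV => _ /(_ i)[].
under eq_bigr do rewrite IE.
have := sum_edges_at_center; rewrite !sum_ord4 (bias0 1) ?(bias0 2) ?(bias0 3) // => E.
have E1 : (K 0 1 + K 1 1 + K 2 1 + K 3 1).1 = (K 0 3 + K 1 3 + K 2 3 + K 3 3).1 by rewrite E.
have E2 : (K 0 1 + K 1 1 + K 2 1 + K 3 1).2 = (K 0 3 + K 1 3 + K 2 3 + K 3 3).2 by rewrite E.
(* Solving the equality of the two sums for [K 0 1] makes the telescoping of the diagonal terms a
   ring identity. *)
have {}E1 : (K 0 1).1 = (K 0 3).1 + (K 1 3).1 + (K 2 3).1 + (K 3 3).1
    - (K 1 1).1 - (K 2 1).1 - (K 3 1).1.
  by move: E1; rewrite !fstsndE; lra.
have {}E2 : (K 0 1).2 = (K 0 3).2 + (K 1 3).2 + (K 2 3).2 + (K 3 3).2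
    - (K 1 1).2 - (K 2 1).2 - (K 3 1).2.
  by move: E2; rewrite !fstsndE; lra.
by rewrite /det2 !fstsndE E1 E2 /=; ring.
Qed.

Lemma consistency_error_neq0 : (forall i, i != 0 -> bias (K i) = 0) -> bias (K 0) != 0 ->
  ~ (v = cst 0 %[ae (area R) in patch_domain K]) ->
  exists phi : R * R -> R, smooth_on (patch_domain K) phi /\
    \sum_(i < 4) (\int[area R]_(x in cell (K i)) grad_dot phi (p i) x)
      + \int[area R]_(x in patch_domain K) (laplacian phi x * v x) != 0.
Proof.
move=> bias0 b0 /QBL0_center_neq0 p0; set b := bias (K 0) in b0 *.
pose g : R * R := (b.2, - b.1).
exists (affine_form 0 g.1 g.2); split; first exact: smooth_affine_form.
have -> : \int[area R]_(x in patch_domain K) (laplacian (affine_form 0 g.1 g.2) x * v x) = 0.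
  rewrite /Rintegral integral0_eq // => x _.
  by rewrite laplacian_affine_form mul0r.
rewrite addr0 consistency_error_linear // oppr_eq0 -/b.
have [_ _ _ _ ab1] := vertex_coords (convK 0).
(* The bound on the shape parameters makes both numerator and denominator positive. *)
have twist0 : twist (K 0) != 0.
  rewrite /twist mulf_neq0 // ?invr_eq0 ?mulf_neq0 ?pnatr_eq0 //.
    have := ler_norm (alpha (K 0)); have := ler_norm (beta (K 0)).
    by move=> ? ?; apply: lt0r_neq0; lra.
  exact: lt0r_neq0 (shape_parameters_sqr ab1).
(* The quarter turn is chosen so that this determinant is the squared length of [b]. *)
have gb : det2 g b = b.1 ^+ 2 + b.2 ^+ 2 by rewrite /det2 /g /=; ring.
have gb0 : det2 g b != 0.
  rewrite gb; apply: contra_neq b0 => /eqP.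
  by rewrite paddr_eq0 ?sqr_ge0 // !sqrf_eq0 => /andP[/eqP b1 /eqP b2]; exact: eq_plane.
have h83 : (8 / 3 : R) != 0 by apply: lt0r_neq0; lra.
exact: mulf_neq0 (mulf_neq0 (mulf_neq0 h83 p0) twist0) gb0.
Qed.

End NormalizedPatch.

(** * Reduction to a patch in which [D] has index 0 in every cell *)

Theorem theorem18 (R : realType) (K : 'I_4 -> 'I_4 -> R * R) (D : R * R)
    (patchK : is_patch K D)
    (parK : forall i : 'I_4, i != 0 -> alpha (K i) = 0 /\ beta (K i) = 0)
    (alpha1 : alpha (K 0) != 0) (beta1 : beta (K 0) != 0)
    (v : R * R -> R) (p : 'I_4 -> R * R -> R)
    (vV : VQBL0 K v p)
    (v_neq0 : ~ (v = cst 0 %[ae (area R) in patch_domain K])) :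
  exists phi : R * R -> R, smooth_on (patch_domain K) phi /\
    \sum_(i < 4) (\int[area R]_(x in cell (K i)) grad_dot phi (p i) x)
      + \int[area R]_(x in patch_domain K) (laplacian phi x * v x) != 0.
Proof.
have vertexD i : exists k, K i k = D.
  case: patchK => _ _ /(_ i)[P [[k [] [kE lE]] _]] _ _; first by exists k.
  by exists (k + 1).
(* Rotating each numbering by [k i] gives [D] index 0. Cells, edges and local polynomial spaces are
   unchanged, so the patch, the function and the integrals carry over. *)
have [k kD] := boolp.choice vertexD.
pose K' i := relabel (K i) (k i).
have K'0 i : K' i 0 = D by rewrite /K' /relabel addr0 kD.
have cellK' i : cell (K' i) = cell (K i) by exact: cell_relabel.
have domK' : patch_domain K' = patch_domain K.
  by rewrite /patch_domain; apply: eq_bigcupr => i _; exact: cellK'.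
have [convK disjK edgeK intK bdK] := patchK.
have edgeK' i P Q : is_edge (K' i) P Q <-> is_edge (K i) P Q by exact: is_edge_relabel.
have patchK' : is_patch K' D.
  split; rewrite ?domK' //.
  - by move=> i; exact: convex_ccw_relabel.
  - by move=> i j ij; rewrite !cellK'; exact: disjK.
  - by move=> i; have [P [Pi Pi1]] := edgeK i; exists P; split; apply/edgeK'.
  - by move=> i l; exact: bdK.
have vV' : VQBL0 K' v p.
  have [Lv pQ pI pB] := vV; split; rewrite ?domK' //.
  - by move=> i; rewrite cellK'; have [pQi vp] := pQ i; split => //; exact: QBL_relabel.
  - by move=> i j P Q ij /edgeK' Pi /edgeK' Pj; exact: pI Pi Pj.
  - by move=> i P Q /edgeK'; exact: pB.
(* The shape parameters are given for the original numbering; [bias_relabel_eq0] transfers their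
   vanishing to the rotated one. *)
have bias0 i : i != 0 -> bias (K' i) = 0.
  by move=> i0; apply/(bias_relabel_eq0 _ (convK i)); exact: parK.
have biasK0 : bias (K' 0) != 0.
  by apply/eqP => /(bias_relabel_eq0 _ (convK 0))[a0 _]; rewrite a0 eqxx in alpha1.
have v_neq0' : ~ (v = cst 0 %[ae (area R) in patch_domain K']) by rewrite domK'.
have [phi [sphi err]] := consistency_error_neq0 patchK' K'0 vV' bias0 biasK0 v_neq0'.
exists phi; rewrite -domK'; split; first exact: sphi.
suff -> : \sum_(i < 4) (\int[area R]_(x in cell (K i)) grad_dot phi (p i) x) =
    \sum_(i < 4) (\int[area R]_(x in cell (K' i)) grad_dot phi (p i) x) by exact: err.
by apply: eq_bigr => i _; rewrite cellK'.
Qed.
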